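(* Suppose $H(\Lambda)$ is lattice with maximal span $h>0$. Let $E_N\in\operatorname{im}(H_N)$ (for $N\ge1$) satisfy $E_N/N\to u>0$, and set $\beta=m^{-1}(u)$. Then for every $k\geq1$, $$\left\|(\pi_k)_*\mu^{\mathrm{sh}}_{N,E_N}-p_{\beta}^{\otimes k}\right\|_{\mathrm{TV}}\to0,\quad N\to+\infty.$$ Moreover, let $u_N=E_N/N$ and $\beta_N=m^{-1}(u_N)$ (defined for all sufficiently large $N$). Then, as $N\to+\infty$, $$g_N(E_N)=\frac{h\,Z(\beta_N)^Ne^{\beta_NE_N}}{\sqrt{2\pi N\sigma^2(\beta_N)}}(1+o(1)).$$ Consequently, $$\lim_{N\to+\infty}\frac{1}{N}\log g_N(E_N)=\psi(\beta)+\beta u=s(u).$$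
   Context: $\Lambda$ is a free $\mathbb{Z}$-module of finite rank $d\geq1$, $\|\cdot\|$ is a Euclidean norm (coming from an inner product) on $\Lambda\otimes_{\mathbb{Z}}\mathbb{R}$, and $H(x)=\|x\|^2$ for $x\in\Lambda$. A subset $A\subseteq\mathbb{R}$ is called lattice if $A\subseteq a+h\mathbb{Z}$ for some $a\in\mathbb{R}$, $h>0$. Since $0\in H(\Lambda)$, if $H(\Lambda)$ is lattice there is a unique $h>0$, the maximal span, such that $H(\Lambda)\subseteq h\mathbb{Z}$ and the subgroup of $\mathbb{Z}$ generated by $\{H(x)/h:x\in\Lambda\}$ is $\mathbb{Z}$. For $\beta>0$: $Z(\beta)=\sum_{x\in\Lambda}e^{-\beta H(x)}$, $\psi(\beta)=\log Z(\beta)$, $p_\beta(x)=Z(\beta)^{-1}e^{-\beta H(x)}$ (a probability measure on $\Lambda$), $m(\beta)=\mathbb{E}_{p_\beta}[H]$, $\sigma^2(\beta)=\operatorname{Var}_{p_\beta}[H]$. The function $m:(0,+\infty)\to(0,+\infty)$ is a decreasing bijection, with inverse $m^{-1}$. For $u>0$, $s(u)=\inf_{\theta>0}\{\psi(\theta)+\theta u\}$. For $N\geq1$ and $x=(x_1,\dots,x_N)\in\Lambda^N$, $H_N(x)=\sum_{i=1}^NH(x_i)$; $\Gamma_N(E)=\{x\in\Lambda^N:H_N(x)=E\}$, $g_N(E)=\#\Gamma_N(E)$ (finite), and for $E\in\operatorname{im}(H_N)$, $\mu^{\mathrm{sh}}_{N,E}$ is the uniform probability measure on $\Gamma_N(E)$.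 For $N\geq k$, $\pi_k:\Lambda^N\to\Lambda^k$ is the projection onto the first $k$ coordinates, $(\pi_k)_*$ is push-forward, and $\|\mu-\nu\|_{\mathrm{TV}}=\sup_A|\mu(A)-\nu(A)|=\frac12\sum_x|\mu(x)-\nu(x)|$ for probability measures on a countable set. *)

(* Defs.v *)
From HB Require Import structures.
From mathcomp Require Import all_boot all_order all_algebra finmap.
From mathcomp Require Import all_classical all_reals all_analysis.

Set Implicit Arguments.
Unset Strict Implicit.
Unset Printing Implicit Defensive.

Import Order.TTheory GRing.Theory Num.Theory.
Import numFieldNormedType.Exports.

Local Open Scope classical_set_scope.
Local Open Scope ring_scope.

(* Throughout, real-valued infinite sums are [fine (\esum_(x in A) (f x)%:E)];
   \esum is the sum of nonnegative terms, and every f below is nonnegative on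
   the range of parameters of interest. *)

Section euclidean_lattice.
Variable R : realType.

(* (V, iota) is the real vector space obtained from the Z-module L by extension
   of scalars, i.e. L (x)_Z R with iota x = x (x) 1, characterized by its
   universal property. *)
Definition extension_of_scalars (L : zmodType) (V : lmodType R)
    (iota : {additive L -> V}) : Prop :=
  forall (W : lmodType R) (f : {additive L -> W}),
    exists g : {linear V -> W}, (forall x, g (iota x) = f x) /\
      forall g' : {linear V -> W},
        (forall x, g' (iota x) = f x) -> forall v, g' v = g v.

Definition euclidean_norm (V : lmodType R) (nrm : V -> R) : Prop :=
  exists ip : {dot V for idfun}, forall v, nrm v = Num.sqrt (ip v v).

Definition energy (L : zmodType) (V : lmodType R) (iota : {additive L -> V})
  (nrm : V -> R) (x : L) : R := nrm (iota x) ^+ 2.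

End euclidean_lattice.

Section lattice_sets.
Variable R : realType.

Definition is_lattice (A : set R) : Prop :=
  exists a h : R, 0 < h /\ A `<=` [set a + h * z%:~R | z in [set: int]].

Definition is_subgroup (G : set int) : Prop :=
  G 0 /\ forall m n, G m -> G n -> G (m - n).

Definition maximal_span (A : set R) (h : R) : Prop :=
  [/\ 0 < h, A `<=` [set h * z%:~R | z in [set: int]] &
      smallest is_subgroup [set z : int | exists2 a, A a & a / h = z%:~R]
        = [set: int]].

End lattice_sets.

Section discrete_probability.
Variable R : realType.

(* A probability measure on a countable set T is represented by its mass
   function T -> R. *)

Definition uniform (T : choiceType) (A : set T) (x : T) : R :=
  \1_A x / #|` fset_set A|%:R.

Definition pushforward_mass (T U : choiceType) (f : T -> U) (mu : T -> R)
  (y : U) : R := fine (\esum_(x in f @^-1` [set y]) (mu x)%:E).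

Definition product_mass (T : choiceType) (mu : T -> R) (k : nat)
  (y : k.-tuple T) : R := \prod_(i < k) mu (tnth y i).

Definition tv_dist (T : choiceType) (mu nu : T -> R) : R :=
  2^-1 * fine (\esum_(x in [set: T]) `|mu x - nu x|%:E).

(* for X >= 0 *)
Definition mean (T : choiceType) (mu X : T -> R) : R :=
  fine (\esum_(x in [set: T]) (X x * mu x)%:E).

Definition variance_mass (T : choiceType) (mu X : T -> R) : R :=
  mean mu (fun x => (X x - mean mu X) ^+ 2).

End discrete_probability.

(* On N-tuples with k <= N this is the projection onto the first k coordinates;
   padding with 0 makes it total in N. *)
Definition proj_first (L : zmodType) (k N : nat) (x : N.-tuple L) : k.-tuple L :=
  [tuple nth 0 x i | i < k].

Section statistical_mechanics.
Variables (R : realType) (T : choiceType) (H : T -> R).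

Definition partition_fun (beta : R) : R :=
  fine (\esum_(x in [set: T]) (expR (- beta * H x))%:E).

Definition log_partition (beta : R) : R := ln (partition_fun beta).

Definition gibbs (beta : R) (x : T) : R :=
  (partition_fun beta)^-1 * expR (- beta * H x).

Definition mean_energy (beta : R) : R := mean (gibbs beta) H.

Definition var_energy (beta : R) : R := variance_mass (gibbs beta) H.

(* the inverse of mean_energy : (0, +oo) -> (0, +oo) *)
Definition mean_energy_inv : R -> R :=
  'pinv_(fun=> 1) [set beta : R | 0 < beta] mean_energy.

Definition entropy (u : R) : R :=
  inf [set log_partition theta + theta * u | theta in [set t : R | 0 < t]].

Definition total_energy (N : nat) (x : N.-tuple T) : R :=
  \sum_(i < N) H (tnth x i).

Definition shell (N : nat) (E : R) : set (N.-tuple T) :=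
  [set x | total_energy x = E].

Definition shell_card (N : nat) (E : R) : nat := #|` fset_set (@shell N E)|.

Definition shell_measure (N : nat) (E : R) : N.-tuple T -> R :=
  uniform R (@shell N E).

End statistical_mechanics.

(* Main.v *)
(* Writing H = h n with n integer valued, the number of points of the shell
   H_N = h e, multiplied by exp (- b h e) / Z(b)^N, is the probability that N
   independent Gibbs variables n(X_i) add up to e.  Fourier inversion turns it into
   an integral over [-pi, pi] of the N-th power of a characteristic function, which
   after the scaling t = s / sqrt N converges to a Gaussian integral by dominated
   convergence, provided that e is within O(1) of the mean and that the parameter
   b = b_N converges.  To keep every exponential sum finite, the Gibbs measure is
   truncated to a finite set F_N that contains all points of energy at most h e and
   all but O(1 / N^2) of the first moments; the truncation does not affect the
   count.  The Gaussian domination comes from the maximality of the span: it gives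
   1 - cos t <= C * sum_(x in F) (1 - cos (t n(x))) for a finite set F.

   With b_N chosen so that the mean is exactly E_N / N this is the asymptotic
   formula, and its logarithm is the entropy (the infimum defining s(u) is attained
   at b by the Gibbs inequality).  The k-point marginal of the shell measure at y is
   g_(N-k)(E_N - H_k(y)) / g_N(E_N); applying the local limit theorem twice with the
   same b_N gives its pointwise limit, and Scheffe's lemma the convergence in total
   variation.  Summability of the Gibbs weights and finiteness of the shells follow
   from a lower bound of H by the coordinates in a basis of the lattice, obtained
   from the dual basis and the Cauchy-Schwarz inequality. *)
Require Import Defs.
From HB Require Import structures.
From mathcomp Require Import all_boot all_order all_algebra finmap.
From mathcomp Require Import all_classical all_reals all_analysis.
From mathcomp Require Import measurable_realfun complex ring lra.
Set Implicit Arguments.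
Unset Strict Implicit.
Unset Printing Implicit Defensive.
Import Order.TTheory GRing.Theory Num.Theory.
Import numFieldNormedType.Exports.
Local Open Scope classical_set_scope.
Local Open Scope ring_scope.

(** * Sums of nonnegative families *)

Section nonneg_sums.
Variables (R : realType) (T : choiceType).
Implicit Types (f g : T -> R) (F : {fset T}).

Definition rsum f : R := fine (\esum_(x in [set: T]) (f x)%:E).

Definition nnsummable f :=
  (forall x, 0 <= f x) /\ (\esum_(x in [set: T]) (f x)%:E < +oo)%E.

Lemma fset_sum_le_esum f F :
  ((\sum_(x <- F) f x)%:E <= \esum_(x in [set: T]) (f x)%:E)%E.
Proof.
apply: esum_ge; exists [set` F]; first by split => //; exact: finite_fset.
by rewrite fsbig_finite/= ?set_fsetK ?sumEFin//; exact: finite_fset.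
Qed.

Lemma rsumE f : nnsummable f ->
  \esum_(x in [set: T]) (f x)%:E = (rsum f)%:E.
Proof.
case=> f0 fy; rewrite /rsum fineK// fin_real// fy andbT.
by rewrite (lt_le_trans _ (esum_ge0 _)) => [//|//|x _]; rewrite ?ltNyr ?lee_fin.
Qed.

Lemma fset_sum_le_rsum f F : nnsummable f -> \sum_(x <- F) f x <= rsum f.
Proof. by move=> fs; rewrite -lee_fin -rsumE//; exact: fset_sum_le_esum. Qed.

Lemma rsum_ge0 f : nnsummable f -> 0 <= rsum f.
Proof.
by move=> fs; rewrite (le_trans _ (fset_sum_le_rsum fset0 fs))// big_seq_fset0.
Qed.

Lemma rsum_ge f x : nnsummable f -> f x <= rsum f.
Proof. by move=> fs; have := fset_sum_le_rsum [fset x]%fset fs; rewrite big_seq_fset1. Qed.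

Lemma nnsummable_bounded f B : (forall x, 0 <= f x) ->
  (forall F, \sum_(x <- F) f x <= B) -> nnsummable f /\ rsum f <= B.
Proof.
move=> f0 fB.
have leB : (\esum_(x in [set: T]) (f x)%:E <= B%:E)%E.
  apply: ge_ereal_sup => _ [X [finX _] <-].
  by rewrite fsbig_finite//= sumEFin lee_fin.
have fs : nnsummable f by split => //; rewrite (le_lt_trans leB)// ltry.
by split=> //; rewrite -lee_fin -rsumE.
Qed.

Lemma rsum_approx f e F0 : nnsummable f -> 0 < e ->
  exists F, (F0 `<=` F)%fset /\ rsum f - e < \sum_(x <- F) f x.
Proof.
move=> fs e0; have [f0 _] := fs.
have : ((rsum f - e)%:E < \esum_(x in [set: T]) (f x)%:E)%E.
  by rewrite rsumE// lte_fin ltrBlDr ltrDl.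
move=> /ereal_sup_gt[_ [X [finX _] <-]].
rewrite fsbig_finite//= sumEFin lte_fin => ltX.
exists (F0 `|` fset_set X)%fset; split; first exact: fsubsetUl.
apply: (lt_le_trans ltX); rewrite [leRHS](big_fsetID _ (fun x => x \in fset_set X))/=.
rewrite -[leLHS]addr0 lerD ?sumr_ge0//.
rewrite le_eqVlt; apply/orP; left; apply/eqP.
apply: eq_fbigl => x; rewrite !inE/=; case: (x \in _) => //=.
all: by rewrite ?andbT ?orbT ?andbF.
Qed.

Lemma nnsummable_le f g : nnsummable g -> (forall x, 0 <= f x <= g x) ->
  nnsummable f /\ rsum f <= rsum g.
Proof.
move=> gs fg; apply: nnsummable_bounded => [x|F]; first by case/andP: (fg x).
apply: (le_trans _ (fset_sum_le_rsum F gs)).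
by apply: ler_sum => x _; case/andP: (fg x).
Qed.

Lemma nnsummableD f g : nnsummable f -> nnsummable g ->
  nnsummable (f \+ g) /\ rsum (f \+ g) = rsum f + rsum g.
Proof.
move=> fs gs; have [f0 _] := fs; have [g0 _] := gs.
have e : \esum_(x in [set: T]) ((f \+ g) x)%:E = (rsum f + rsum g)%:E.
  rewrite EFinD -!rsumE//.
  rewrite (@eq_esum _ _ _ _ (fun x => (f x)%:E + (g x)%:E)%E)//.
  by rewrite esumD// => x _; rewrite lee_fin.
split; last by rewrite /rsum e.
by split => [x|]; [rewrite addr_ge0|rewrite e ltry].
Qed.

Lemma nnsummableZ f c : 0 <= c -> nnsummable f ->
  nnsummable (fun x => c * f x) /\ rsum (fun x => c * f x) = c * rsum f.
Proof.
move=> c0 fs; have [f0 _] := fs.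
(* Only an upper bound is proved directly; used with [c] and then with [c^-1] it gives the
   equality. *)
have h c' f' : 0 <= c' -> nnsummable f' -> nnsummable (fun x => c' * f' x) /\
    rsum (fun x => c' * f' x) <= c' * rsum f'.
  move=> c'0 f's; have [f'0 _] := f's.
  apply: nnsummable_bounded => [x|F]; first by rewrite mulr_ge0.
  by rewrite -mulr_sumr ler_wpM2l// fset_sum_le_rsum.
have [cfs le1] := h c f c0 fs; split => //.
apply/eqP; rewrite eq_le le1/=.
have [->|cn0] := eqVneq c 0.
  by rewrite mul0r rsum_ge0//; have [] := h 0 f (lexx _) fs.
have {}c0 : 0 < c by rewrite lt_neqAle eq_sym cn0.
have [_] := h c^-1 _ (ltW (etrans (invr_gt0 c) c0)) cfs.
rewrite ler_pdivlMl//.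
apply: le_trans; rewrite le_eqVlt; apply/orP; left; apply/eqP.
by congr (_ * rsum _); apply/funext => x; rewrite mulKf.
Qed.

End nonneg_sums.

Lemma sum_fset_val (R : realType) (T : choiceType) (F : {fset T}) (f : T -> R) :
  \sum_(i : F) f (val i) = \sum_(x <- F) f x.
Proof. by rewrite big_seq_fsetE. Qed.

(** * Finite approximation and signed combinations of sums *)

Section linear_combinations.
Variables (R : realType) (T : choiceType).
Implicit Types (f g : T -> R) (F : {fset T}).

Lemma ler_sum_fset f g F : (forall x, x \in F -> f x <= g x) ->
  \sum_(x <- F) f x <= \sum_(x <- F) g x.
Proof.
by move=> fg; rewrite big_seq [leRHS]big_seq; apply: ler_sum => x; apply: fg.
Qed.

Lemma fset_sum_mono f F G : (forall x, 0 <= f x) -> (F `<=` G)%fset ->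
  \sum_(x <- F) f x <= \sum_(x <- G) f x.
Proof.
move=> f0 FG; rewrite [leRHS](big_fsetID _ (fun x => x \in F))/=.
rewrite -[leLHS]addr0 lerD ?sumr_ge0//.
rewrite le_eqVlt; apply/orP; left; apply/eqP.
apply: eq_fbigl => x; rewrite !inE/=; have [xF|] := boolP (x \in F).
  by rewrite (fsubsetP FG).
by rewrite andbF.
Qed.

(** Partial sums increase with the finite set, so enlarging it three times in turn serves the three
    sums at once. *)
Lemma rsum_approx3 f0 f1 f2 e F0 : nnsummable f0 -> nnsummable f1 ->
  nnsummable f2 -> 0 < e -> exists F, [/\ (F0 `<=` F)%fset,
    `|\sum_(x <- F) f0 x - rsum f0| <= e, `|\sum_(x <- F) f1 x - rsum f1| <= e
    & `|\sum_(x <- F) f2 x - rsum f2| <= e].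
Proof.
move=> s0 s1 s2 e0.
have [A [FA hA]] := rsum_approx F0 s0 e0.
have [B [AB hB]] := rsum_approx A s1 e0.
have [F [BF hF]] := rsum_approx B s2 e0.
have close f G : nnsummable f -> (G `<=` F)%fset ->
    rsum f - e < \sum_(x <- G) f x -> `|\sum_(x <- F) f x - rsum f| <= e.
  move=> fs GF hG; rewrite ler0_norm ?subr_le0 ?fset_sum_le_rsum//.
  by have := fset_sum_mono fs.1 GF; lra.
exists F; split; [|apply: close hA|apply: close hB|exact: close hF] => //.
- exact: fsubset_trans FA (fsubset_trans AB BF).
- exact: fsubset_trans AB BF.
Qed.

(** Signed coefficients leave the range of [\esum], so the pointwise inequality is summed over a
    finite set containing [x0] and the error is sent to 0. The lower bound [d] at the single point
    [x0] is what later makes inequalities strict. *)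
Lemma rsum_lin_ge f0 f1 f2 (c0 c1 c2 d : R) x0 : nnsummable f0 -> nnsummable f1 ->
  nnsummable f2 ->
  (forall x, 0 <= c0 * f0 x + c1 * f1 x + c2 * f2 x) ->
  d <= c0 * f0 x0 + c1 * f1 x0 + c2 * f2 x0 ->
  d <= c0 * rsum f0 + c1 * rsum f1 + c2 * rsum f2.
Proof.
move=> s0 s1 s2 ge0 ged; apply/ler_addgt0Pr => e e0.
pose C := `|c0| + `|c1| + `|c2| + 1.
have C0 : 0 < C by rewrite ltr_wpDl// !addr_ge0.
have [F [xF h0 h1 h2]] := rsum_approx3 [fset x0]%fset s0 s1 s2 (divr_gt0 e0 C0).
have hF : d <= \sum_(x <- F) (c0 * f0 x + c1 * f1 x + c2 * f2 x).
  apply: (le_trans ged); have := fset_sum_mono ge0 xF.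
  by rewrite big_seq_fset1.
apply: (le_trans hF); rewrite !big_split/= -!mulr_sumr.
have h c a b : `|a - b| <= e / C -> c * a <= c * b + `|c| * (e / C).
  move=> ab; rewrite -lerBlDl -mulrBr (le_trans (ler_norm _))// normrM.
  by rewrite ler_wpM2l.
have := h c0 _ _ h0; have := h c1 _ _ h1; have := h c2 _ _ h2.
have : (`|c0| + `|c1| + `|c2|) * (e / C) <= e.
  rewrite mulrCA ler_piMr ?(ltW e0)// ler_pdivrMr// mul1r /C; lra.
by rewrite !mulrDl; lra.
Qed.

End linear_combinations.

(** * Moments of the Gibbs measure *)

Section moments.
Variables (R : realType) (T : choiceType) (H : T -> R).
Hypothesis H0 : forall x, 0 <= H x.
Hypothesis Zs : forall b, 0 < b -> nnsummable (fun x => expR (- b * H x)).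
Implicit Types (b t : R) (j : nat).

Definition moment j b : R := rsum (fun x => H x ^+ j * expR (- b * H x)).

(** Induction on [j]: one factor [H x] is absorbed by half of the exponential, since
    [b / 2 * H x <= expR (b / 2 * H x)]. *)
Lemma nnsummable_moment j b : 0 < b ->
  nnsummable (fun x => H x ^+ j * expR (- b * H x)).
Proof.
elim: j b => [|j IHj] b b0.
  rewrite (_ : (fun _ => _) = (fun x => expR (- b * H x))); first exact: Zs.
  by apply/funext => x; rewrite mul1r.
have b2 : 0 < b / 2 by rewrite divr_gt0.
have bV : 0 <= (b / 2)^-1 by rewrite invr_ge0 ltW.
apply: (nnsummable_le (nnsummableZ bV (IHj _ b2)).1 _).1 => x.
rewrite mulr_ge0 ?exprn_ge0 ?expR_ge0//=.
rewrite exprSr -mulrA [leRHS]mulrCA ler_wpM2l ?exprn_ge0//.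
have -> : - b * H x = - (b / 2 * H x) + - (b / 2) * H x by field.
rewrite expRD mulrA ler_wpM2r ?expR_ge0// expRN ler_pdivrMr ?expR_gt0//.
rewrite ler_pdivlMl//.
by rewrite (le_trans _ (expR_ge1Dx _))// lerDr.
Qed.

Lemma moment_ge0 j b : 0 < b -> 0 <= moment j b.
Proof. by move=> b0; apply: rsum_ge0; exact: nnsummable_moment. Qed.

Lemma moment_anti j b b' : 0 < b -> b <= b' -> moment j b' <= moment j b.
Proof.
move=> b0 bb'; apply: (nnsummable_le (nnsummable_moment j b0) _).2 => x.
rewrite mulr_ge0 ?exprn_ge0 ?expR_ge0//= ler_wpM2l ?exprn_ge0// ler_expR.
by rewrite ler_wpM2r// lerN2.
Qed.

(** Summed form of [1 - y <= expR (- y)] at [y = (b' - b) * H x]. With monotonicity in [b] it makes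
    [moment j] locally Lipschitz, without differentiating under the sum. *)
Lemma moment_lip (x0 : T) j b b' : 0 < b -> b <= b' ->
  moment j b <= moment j b' + (b' - b) * moment j.+1 b.
Proof.
move=> b0 bb'; have b'0 := lt_le_trans b0 bb'.
suff h x : 0 <= 1 * (H x ^+ j * expR (- b' * H x)) +
    (b' - b) * (H x ^+ j.+1 * expR (- b * H x)) +
    (-1) * (H x ^+ j * expR (- b * H x)).
  have := @rsum_lin_ge R T _ _ _ 1 (b' - b) (-1) 0 x0 (nnsummable_moment j b'0)
    (nnsummable_moment j.+1 b0) (nnsummable_moment j b0) h (h x0).
  by rewrite -/(moment j b') -/(moment j.+1 b) -/(moment j b); lra.
rewrite exprS (_ : _ + _ = H x ^+ j * (expR (- b' * H x) +
  ((b' - b) * H x - 1) * expR (- b * H x))); last by ring.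
rewrite mulr_ge0 ?exprn_ge0//.
have -> : - b' * H x = - ((b' - b) * H x) + - b * H x by ring.
rewrite expRD -mulrDl mulr_ge0 ?expR_ge0//.
have := expR_ge1Dx (- ((b' - b) * H x)); lra.
Qed.

Lemma moment_continuous (x0 : T) j b : 0 < b -> {for b, continuous (moment j)}.
Proof.
move=> b0; apply/cvgrPdist_le => e e0.
have b2 : 0 < b / 2 by rewrite divr_gt0.
pose M := moment j.+1 (b / 2) + 1.
have M0 : 0 < M by rewrite ltr_wpDl// moment_ge0.
have M1 c : b / 2 <= c -> moment j.+1 c <= M.
  by move=> bc; rewrite (le_trans (moment_anti _ b2 bc))// lerDl.
have key c c' : b / 2 <= c -> c <= c' -> c' - c <= e / M ->
    `|moment j c - moment j c'| <= e.
  move=> bc cc' ce; have c0 := lt_le_trans b2 bc.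
  rewrite ger0_norm ?subr_ge0 ?moment_anti//.
  rewrite lerBlDl (le_trans (moment_lip x0 j c0 cc'))// lerD2l.
  rewrite (le_trans (_ : _ <= (c' - c) * M))//.
    by rewrite ler_wpM2l ?subr_ge0// M1.
  by rewrite -ler_pdivlMr.
near=> c.
have bc : b / 2 <= c.
  have : `|b - c| <= b / 2 by near: c; exact: cvgr_dist_le.
  by rewrite ler_norml; lra.
have ce : `|b - c| <= e / M.
  by near: c; apply: cvgr_dist_le => //; rewrite divr_gt0.
have [cb|/ltW cb] := leP b c.
  by apply: key => //; [lra|rewrite (le_trans (ler_norm _))// distrC].
by rewrite distrC; apply: key => //; rewrite (le_trans (ler_norm _)).
Unshelve. all: by end_near. Qed.

Lemma partition_funE b : partition_fun H b = moment 0 b.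
Proof. by rewrite /moment /rsum; under eq_esum do rewrite expr0 mul1r. Qed.

Lemma partition_fun_gt0 (x0 : T) b : 0 < b -> 0 < partition_fun H b.
Proof.
move=> b0; apply: (lt_le_trans (expR_gt0 (- b * H x0))).
exact: (rsum_ge x0 (Zs b0)).
Qed.

Lemma nnsummable_gibbs b f : 0 < b -> T ->
  nnsummable (fun x => f x * expR (- b * H x)) ->
  nnsummable (fun x => f x * gibbs H b x) /\
  rsum (fun x => f x * gibbs H b x) =
    rsum (fun x => f x * expR (- b * H x)) / partition_fun H b.
Proof.
move=> b0 x0 fs; have Z0 := partition_fun_gt0 x0 b0.
rewrite mulrC (_ : (fun x => f x * gibbs H b x) =
  fun x => (partition_fun H b)^-1 * (f x * expR (- b * H x))).
  by apply: nnsummableZ => //; rewrite invr_ge0 ltW.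
by apply/funext => x; rewrite /gibbs mulrCA.
Qed.

Lemma mean_energyE (x0 : T) b : 0 < b ->
  mean_energy H b = moment 1 b / partition_fun H b.
Proof. by move=> b0; exact: (nnsummable_gibbs b0 x0 (nnsummable_moment 1 b0)).2. Qed.

Lemma var_energyE (x0 : T) b : 0 < b ->
  var_energy H b = moment 2 b / partition_fun H b - mean_energy H b ^+ 2.
Proof.
move=> b0; have Z0 := partition_fun_gt0 x0 b0; set m := mean_energy H b.
have m0 : 0 <= m by rewrite /m (mean_energyE x0)// divr_ge0 ?moment_ge0// ltW.
have [s1 e1] := nnsummableZ (sqr_ge0 m) (nnsummable_moment 0 b0).
have [s2 e2] := nnsummableD (nnsummable_moment 2 b0) s1.
have m20 : 0 <= 2 * m by rewrite mulr_ge0.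
have [s3 e3] := nnsummableZ m20 (nnsummable_moment 1 b0).
have vs : nnsummable (fun x => (H x - m) ^+ 2 * expR (- b * H x)).
  apply: (nnsummable_le s2 _).1 => x; rewrite mulr_ge0 ?sqr_ge0 ?expR_ge0//=.
  rewrite expr0 mul1r -mulrDl ler_wpM2r ?expR_ge0//.
  by have := mulr_ge0 (H0 x) m0; lra.
rewrite /var_energy /variance_mass -/(mean_energy H b) -/m.
rewrite [LHS](nnsummable_gibbs b0 x0 vs).2.
have [_ e4] := nnsummableD vs s3.
(* The cross term is moved to the left-hand side so that every sum has nonnegative terms. *)
have e5 : rsum (fun x => (H x - m) ^+ 2 * expR (- b * H x)) +
    2 * m * moment 1 b = moment 2 b + m ^+ 2 * partition_fun H b.
  rewrite partition_funE -e3 -e4 -e1 -e2; congr rsum; apply/funext => x /=.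
  by ring.
have e6 : moment 1 b = m * partition_fun H b.
  by rewrite /m (mean_energyE x0)// divfK// gt_eqF.
rewrite (_ : rsum _ = moment 2 b - m ^+ 2 * partition_fun H b).
  by field; rewrite gt_eqF.
by apply/(addIr (2 * m * moment 1 b)); rewrite e5 e6; ring.
Qed.

Lemma partition_fun_continuous (x0 : T) b : 0 < b ->
  {for b, continuous (partition_fun H)}.
Proof.
move=> b0; rewrite (_ : partition_fun H = moment 0); last first.
  by apply/funext => c; exact: partition_funE.
exact: moment_continuous.
Qed.

Lemma mean_energy_continuous (x0 : T) b : 0 < b ->
  {for b, continuous (mean_energy H)}.
Proof.
move=> b0; have Z0 := partition_fun_gt0 x0 b0.
rewrite /prop_for /continuous_at (mean_energyE x0 b0).
have lim : (fun c => moment 1 c / partition_fun H c) @ b -->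
    moment 1 b / partition_fun H b.
  apply: cvgM; first exact: moment_continuous.
  by apply: cvgV; [rewrite gt_eqF|exact: partition_fun_continuous].
apply: cvg_trans lim; apply: near_eq_cvg; near=> c.
by rewrite (mean_energyE x0)//; near: c; exact: lt_nbhsr.
Unshelve. all: by end_near. Qed.

Lemma var_energy_continuous (x0 : T) b : 0 < b ->
  {for b, continuous (var_energy H)}.
Proof.
move=> b0; have Z0 := partition_fun_gt0 x0 b0.
rewrite /prop_for /continuous_at (var_energyE x0 b0).
have lim : (fun c => moment 2 c / partition_fun H c - mean_energy H c ^+ 2) @ b -->
    moment 2 b / partition_fun H b - mean_energy H b ^+ 2.
  apply: cvgB.
    apply: cvgM; first exact: moment_continuous.
    by apply: cvgV; [rewrite gt_eqF|exact: partition_fun_continuous].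
  by under eq_cvg do rewrite expr2; apply: cvgM; exact: mean_energy_continuous.
apply: cvg_trans lim; apply: near_eq_cvg; near=> c.
by rewrite (var_energyE x0)//; near: c; exact: lt_nbhsr.
Unshelve. all: by end_near. Qed.

Variables (x0 x1 : T).
Hypotheses (Hx0 : H x0 = 0) (Hx1 : 0 < H x1).

Lemma mean_energy_gt0 b : 0 < b -> 0 < mean_energy H b.
Proof.
move=> b0; rewrite (mean_energyE x0)// divr_gt0 ?(partition_fun_gt0 x0)//.
apply: (lt_le_trans _ (rsum_ge x1 (nnsummable_moment 1 b0))).
by rewrite mulr_gt0 ?expR_gt0.
Qed.

(** The point [x0] has energy 0, hence squared deviation [m ^+ 2 > 0] and weight 1: it alone bounds
    the unnormalised variance from below. *)
Lemma var_energy_gt0 b : 0 < b -> 0 < var_energy H b.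
Proof.
move=> b0; have Z0 := partition_fun_gt0 x0 b0; have m0 := mean_energy_gt0 b0.
have vE := var_energyE x0 b0; have mE := mean_energyE x0 b0.
set m := mean_energy H b in m0 vE mE *.
suff : m ^+ 2 <= moment 2 b - 2 * m * moment 1 b + m ^+ 2 * moment 0 b.
  have -> : moment 1 b = m * partition_fun H b by rewrite mE divfK// gt_eqF.
  have -> : moment 2 b = (var_energy H b + m ^+ 2) * partition_fun H b.
    by rewrite vE subrK divfK// gt_eqF.
  rewrite -partition_funE => h.
  have : 0 < var_energy H b * partition_fun H b.
    by have := exprn_gt0 2 m0; lra.
  by rewrite pmulr_lgt0.
have := @rsum_lin_ge R T _ _ _ 1 (- (2 * m)) (m ^+ 2) (m ^+ 2) x0
  (nnsummable_moment 2 b0) (nnsummable_moment 1 b0) (nnsummable_moment 0 b0).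
rewrite -/(moment 0 b) -/(moment 1 b) -/(moment 2 b) => h.
suff : m ^+ 2 <= 1 * moment 2 b + - (2 * m) * moment 1 b + m ^+ 2 * moment 0 b.
  by lra.
apply: h.
- move=> x; rewrite (_ : _ + _ = (H x - m) ^+ 2 * expR (- b * H x)); last by ring.
  by rewrite mulr_ge0 ?sqr_ge0 ?expR_ge0.
- by rewrite Hx0 mulr0 expR0 expr0 !expr0n/=; lra.
Qed.

(* The inequality [1 + y < expR y] for [y = - (t - b) * (H x - m)], averaged
   over the Gibbs measure at [b]; strictness comes from [x0]. *)
Lemma partition_fun_gibbs_lt b t : 0 < b -> 0 < t -> t != b ->
  partition_fun H b < partition_fun H t * expR ((t - b) * mean_energy H b).
Proof.
move=> b0 t0 tb; have Z0 := partition_fun_gt0 x0 b0.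
have m0 := mean_energy_gt0 b0; have mE := mean_energyE x0 b0.
set m := mean_energy H b in m0 mE *.
have eM1 : moment 1 b = m * moment 0 b.
  by rewrite mE -partition_funE divfK// gt_eqF.
pose d := expR ((t - b) * m) - 1 - (t - b) * m.
have d0 : 0 < d.
  have /expR_gt1Dx : (t - b) * m != 0 by rewrite mulf_neq0 ?subr_eq0// gt_eqF.
  by rewrite /d; lra.
have := @rsum_lin_ge R T _ _ _ (expR ((t - b) * m)) (t - b)
  (- (1 + (t - b) * m)) d x0
  (nnsummable_moment 0 t0) (nnsummable_moment 1 b0) (nnsummable_moment 0 b0).
rewrite -/(moment 0 t) -/(moment 1 b) -/(moment 0 b) eM1 !partition_funE => h.
suff : d <= expR ((t - b) * m) * moment 0 t + (t - b) * (m * moment 0 b) +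
    - (1 + (t - b) * m) * moment 0 b by lra.
apply: h => [x|]; last by rewrite Hx0 !mulr0 expR0 !expr0 !expr0n/= /d; lra.
rewrite (_ : _ + _ = expR ((t - b) * m) * expR (- t * H x) -
  (1 + (t - b) * (m - H x)) * expR (- b * H x)); last by ring.
have -> : - t * H x = - ((t - b) * H x) + - b * H x by ring.
rewrite expRD mulrA -expRD -mulrBl mulr_ge0 ?expR_ge0// subr_ge0.
by rewrite (le_trans (expR_ge1Dx _))// ler_expR; lra.
Qed.

(** The strict Gibbs inequality is applied to [b, t] and to [t, b]. Combined, the partition
    functions cancel and [(t - b) * (mean_energy H b - mean_energy H t)] is positive. *)
Lemma mean_energy_decr b t : 0 < b -> b < t -> mean_energy H t < mean_energy H b.
Proof.
move=> b0 bt; have t0 := lt_trans b0 bt.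
have Zt := partition_fun_gt0 x0 t0; have Zb := partition_fun_gt0 x0 b0.
have h1 := partition_fun_gibbs_lt b0 t0 (negbT (gt_eqF bt)).
have h2 := partition_fun_gibbs_lt t0 b0 (negbT (lt_eqF bt)).
have : partition_fun H b < partition_fun H b *
    (expR ((b - t) * mean_energy H t) * expR ((t - b) * mean_energy H b)).
  by apply: (lt_trans h1); rewrite mulrA (ltr_pM2r (expR_gt0 _)); exact: h2.
rewrite ltr_pMr// -expRD expR_gt1.
rewrite (_ : _ + _ = (t - b) * (mean_energy H b - mean_energy H t)); last by ring.
by rewrite pmulr_rgt0 ?subr_gt0.
Qed.

Lemma entropy_legendre b : 0 < b ->
  entropy H (mean_energy H b) = log_partition H b + b * mean_energy H b.
Proof.
move=> b0; set m := mean_energy H b.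
rewrite /entropy; set A := (X in inf X).
have lb y : A y -> log_partition H b + b * m <= y.
  move=> [t /= t0 <-]; have [->//|tb] := eqVneq t b.
  have h := partition_fun_gibbs_lt b0 t0 tb.
  have Zt := partition_fun_gt0 x0 t0; have Zb := partition_fun_gt0 x0 b0.
  rewrite -lerBrDr -addrA -mulrBl /log_partition.
  rewrite -(expRK ((t - b) * m)) -lnM ?posrE ?expR_gt0//.
  by rewrite ler_ln ?posrE ?mulr_gt0 ?expR_gt0// ltW.
have Ab : A (log_partition H b + b * m) by exists b.
apply/eqP; rewrite eq_le; apply/andP; split.
  by apply: ge_inf => //; exists (log_partition H b + b * m).
by apply: lb_le_inf => //; exists (log_partition H b + b * m).
Qed.

End moments.

(** * The inverse of the mean energy *)

Section mean_energy_inverse.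
Variables (R : realType) (T : choiceType) (H : T -> R) (h : R) (x0 x1 : T).
Hypothesis H0 : forall x, 0 <= H x.
Hypothesis Zs : forall b, 0 < b -> nnsummable (fun x => expR (- b * H x)).
Hypotheses (Hx0 : H x0 = 0) (Hx1 : 0 < H x1) (h0 : 0 < h).
Hypothesis gap : forall x, H x = 0 \/ h <= H x.
Hypothesis infT : forall k, exists F : {fset T}, (k <= #|` F|)%N.

(** At inverse temperature 1 each point of the sublevel set weighs at least [expR (- a)], and the
    total weight is finite. *)
Lemma finite_sublevel a : exists F : {fset T}, forall x, H x <= a -> x \in F.
Proof.
have fin : finite_set [set x | H x <= a].
  have [B ZB] : exists B : R, forall F : {fset T}, {subset F <= [set x | H x <= a]} ->
      #|` F|%:R <= B.
    exists (rsum (fun x => expR (- 1 * H x)) * expR a) => F FA.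
    rewrite -ler_pdivrMr ?expR_gt0// -expRN.
    rewrite (le_trans _ (fset_sum_le_rsum F (Zs ltr01)))//.
    rewrite -sum1_size natr_sum mulr_suml; apply: ler_sum_fset => x xF.
    by rewrite mul1r ler_expR mulN1r lerN2; have := FA x xF; rewrite inE.
  apply: contrapT => /(infinite_set_fset (Num.truncn B).+1)[F FA FB]; have := ZB F.
  rewrite leNgt => /(_ _)/negP; apply.
    by move=> x xF; rewrite inE; exact: FA.
  by rewrite (lt_le_trans (truncnS_gt _))// ler_nat.
exists (fset_set [set x | H x <= a]) => x xa.
by rewrite in_fset_set// inE.
Qed.

Lemma mean_energy_small (u : R) : 0 < u -> exists2 b, 0 < b & mean_energy H b <= u.
Proof.
move=> u0; have M0 := moment_ge0 H0 Zs 1 ltr01.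
(* Chosen so that [moment H 1 1 = u * (c * h)]. By the gap, passing from 1 to [1 + c] multiplies the
   first moment by at most [expR (- (c * h))], and [y * expR (- y) <= 1]. *)
pose c := moment H 1 1 / (u * h); exists (1 + c).
  by rewrite ltr_wpDr// divr_ge0// mulr_ge0 ?ltW.
have c0 : 0 <= c by rewrite divr_ge0// mulr_ge0 ?ltW.
have b0 : 0 < 1 + c by rewrite ltr_wpDr.
have Z1 : 1 <= partition_fun H (1 + c).
  by have := rsum_ge x0 (Zs b0); rewrite Hx0 mulr0 expR0.
rewrite (mean_energyE H0 Zs x0)// ler_pdivrMr ?(partition_fun_gt0 Zs x0)//.
rewrite (@le_trans _ _ u)//; last by rewrite ler_peMr// ltW.
have [_ e] := nnsummableZ (expR_ge0 (- (c * h))) (nnsummable_moment H0 Zs 1 ltr01).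
apply: (@le_trans _ _ (expR (- (c * h)) * moment H 1 1)).
  rewrite /moment -e; apply: (nnsummable_le _ _).2 => [|x].
    exact: (nnsummableZ (expR_ge0 _) (nnsummable_moment H0 Zs 1 ltr01)).1.
  rewrite mulr_ge0 ?expr1 ?expR_ge0//= mulrCA.
  have [->|hx] := gap x; first by rewrite !mul0r.
  rewrite ler_wpM2l// -expRD ler_expR.
  have := ler_wpM2l c0 hx; lra.
rewrite expRN mulrC ler_pdivrMr ?expR_gt0//.
have e1 : moment H 1 1 = u * (c * h).
  by rewrite /c; field; rewrite !gt_eqF.
rewrite e1 ler_pM2l//; have := expR_ge1Dx (c * h); lra.
Qed.

(** More than [2 * A] points are taken, with [b] so small that each of them has weight at least
    1/2. *)
Lemma partition_fun_large (A : R) : exists2 b, 0 < b & A <= partition_fun H b.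
Proof.
have [F AF] := infT (Num.truncn (2 * A)).+1.
pose M := \sum_(x <- F) H x + 1.
have M0 : 0 < M by rewrite ltr_wpDl// sumr_ge0.
have b0 : 0 < (2 * M)^-1 by rewrite invr_gt0 mulr_gt0.
exists (2 * M)^-1 => //.
rewrite (le_trans _ (fset_sum_le_rsum F (Zs b0)))//.
apply: (@le_trans _ _ (\sum_(x <- F) 2^-1)).
  rewrite big_const_seq count_predT iter_addr_0 -[_ *+ size _]mulr_natl.
  rewrite ler_pdivlMr// mulrC (le_trans (ltW (truncnS_gt _)))// ler_nat.
  exact: AF.
apply: ler_sum_fset => x xF; rewrite (le_trans _ (expR_ge1Dx _))//.
have HM : H x <= M.
  rewrite /M (le_trans _ (ler_wpDr ler01 (lexx _)))//.
  by rewrite (big_fsetD1 x)//= lerDl sumr_ge0.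
have : (2 * M)^-1 * H x <= 2^-1.
  by rewrite invfM -mulrA ler_piMr ?invr_ge0// mulrC ler_pdivrMr// mul1r.
lra.
Qed.

(** When the partition function is at least twice the cardinal of [F], the points of energy at most
    [2 * u] carry at most half of the mass; the others have energy above [2 * u]. *)
Lemma mean_energy_large (u : R) : 0 < u -> exists2 b, 0 < b & u <= mean_energy H b.
Proof.
move=> u0; have [F FP] := finite_sublevel (2 * u).
have [b b0 Zb] := partition_fun_large (2 * #|` F|%:R); exists b => //.
have Z0 := partition_fun_gt0 Zs x0 b0.
rewrite (mean_energyE H0 Zs x0)// ler_pdivlMr//.
pose f x := if x \in F then expR (- b * H x) else 0.
have [fs fF] : nnsummable f /\ rsum f <= #|` F|%:R.
  apply: nnsummable_bounded => [x|G]; first by rewrite /f; case: ifP; rewrite ?expR_ge0.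
  rewrite /f -big_mkcond/= -big_filter.
  rewrite (le_trans (_ : _ <= (\sum_(x <- [seq x <- G | x \in F]) 1)%N%:R))//.
    by rewrite natr_sum; apply: ler_sum => x _; rewrite expR_le1 mulNr oppr_le0 mulr_ge0// ltW.
  rewrite sum1_size ler_nat uniq_leq_size//.
    by rewrite filter_uniq// fset_uniq.
  by move=> x; rewrite mem_filter => /andP[].
have := @rsum_lin_ge R T _ _ _ 1 (- (2 * u)) (2 * u) 0 x0
  (nnsummable_moment H0 Zs 1 b0) (nnsummable_moment H0 Zs 0 b0) fs.
rewrite -/(moment H 1 b) -/(moment H 0 b) -partition_funE => lin.
suff : 0 <= 1 * moment H 1 b + - (2 * u) * partition_fun H b + 2 * u * rsum f.
  have : u * (2 * rsum f) <= u * partition_fun H b.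
    by rewrite ler_pM2l// (le_trans _ Zb)// ler_pM2l.
  by lra.
have ge0 x : 0 <= 1 * (H x ^+ 1 * expR (- b * H x)) +
    - (2 * u) * (H x ^+ 0 * expR (- b * H x)) + 2 * u * f x.
  rewrite /f expr0 expr1 !mul1r; case: ifPn => [_|xF].
    by have := mulr_ge0 (H0 x) (expR_ge0 (- b * H x)); lra.
  have Hx : 2 * u <= H x by rewrite leNgt; apply: contra xF => /ltW/FP.
  by rewrite mulr0 addr0 -mulrDl mulr_ge0 ?expR_ge0 ?subr_ge0.
exact: lin.
Qed.

Lemma mean_energy_surj (u : R) : 0 < u -> exists2 b, 0 < b & mean_energy H b = u.
Proof.
move=> u0; have [b b0 bu] := mean_energy_small u0.
have [a a0 au] := mean_energy_large u0.
have [ab|ba] := leP a b.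
  have [||c + <-] := @IVT R (mean_energy H) a b u ab.
  - apply: continuous_in_subspaceT => c; rewrite inE/= in_itv/= => /andP[ac _].
    exact: (mean_energy_continuous H0 Zs x0 (lt_le_trans a0 ac)).
  - by rewrite ge_min bu orbT le_max au.
  - by rewrite in_itv/= => /andP[ac _]; exists c => //; exact: lt_le_trans ac.
have := mean_energy_decr H0 Zs Hx0 Hx1 b0 ba.
by rewrite ltNge (le_trans bu au).
Qed.

Lemma mean_energy_inj : {in [set b : R | 0 < b] &, injective (mean_energy H)}.
Proof.
move=> a b; rewrite !inE/= => a0 b0 ab.
have [lt|lt|//] := ltgtP a b.
  by have := mean_energy_decr H0 Zs Hx0 Hx1 a0 lt; rewrite ab ltxx.
by have := mean_energy_decr H0 Zs Hx0 Hx1 b0 lt; rewrite ab ltxx.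
Qed.

Lemma mean_energy_invP u : 0 < u ->
  0 < mean_energy_inv H u /\ mean_energy H (mean_energy_inv H u) = u.
Proof.
move=> /mean_energy_surj[b b0 <-].
have -> // : mean_energy_inv H (mean_energy H b) = b.
by rewrite /mean_energy_inv pinvKV ?inE//; exact: mean_energy_inj.
Qed.

Lemma mean_energy_inv_cvg (u : R) (u_ : nat -> R) : 0 < u -> u_ @ \oo --> u ->
  (fun N => mean_energy_inv H (u_ N)) @ \oo --> mean_energy_inv H u.
Proof.
move=> u0 uu; have [b0 mb] := mean_energy_invP u0.
set b := mean_energy_inv H u in b0 mb *.
apply/cvgrPdist_lt => e e0.
(* The cap [b / 2] keeps [b - e'] positive, inside the domain where the mean energy decreases. *)
pose e' := Num.min e (b / 2).
have e'0 : 0 < e' by rewrite lt_min e0 divr_gt0.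
have e'b : 0 < b - e' by rewrite subr_gt0 gt_min; apply/orP; right; lra.
have be' : 0 < b + e' by rewrite addr_gt0.
have lo : mean_energy H (b + e') < u.
  by rewrite -mb; apply: (mean_energy_decr H0 Zs Hx0 Hx1); rewrite ?ltrDl.
have hi : u < mean_energy H (b - e').
  by rewrite -mb; apply: (mean_energy_decr H0 Zs Hx0 Hx1); rewrite ?gtrBl.
near=> N.
have uN0 : 0 < u_ N by near: N; exact: (cvgr_gt u).
have ulo : mean_energy H (b + e') < u_ N by near: N; exact: (cvgr_gt u).
have uhi : u_ N < mean_energy H (b - e') by near: N; exact: (cvgr_lt u).
have [c0 mc] := mean_energy_invP uN0.
set c := mean_energy_inv H (u_ N) in c0 mc *.
have anti x y : 0 < x -> 0 < y -> mean_energy H x < mean_energy H y -> y < x.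
  move=> x_gt0 y_gt0; rewrite !ltNge; apply: contra; rewrite le_eqVlt.
  move=> /predU1P[->//|xy]; apply: ltW.
  exact: (mean_energy_decr H0 Zs Hx0 Hx1).
have : c < b + e' by apply: anti => //; rewrite mc.
have : b - e' < c by apply: anti => //; rewrite mc.
have : e' <= e by rewrite ge_min lexx.
by rewrite ltr_norml; lra.
Unshelve. all: by end_near. Qed.

End mean_energy_inverse.

(** * Trigonometric bounds *)

Section trigonometric_bounds.
Variable R : realType.
Implicit Types (x t : R) (f df : R -> R).

(** The Taylor bounds on sine and cosine below follow by iterating this: the derivative of each
    remainder is already known to be nonnegative. *)
Lemma derive_ge0_ge0 f df x : 0 <= x -> (forall x, is_derive x 1 f (df x)) ->
  (forall x, 0 <= x -> 0 <= df x) -> 0 <= f 0 -> 0 <= f x.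
Proof.
move=> x0 fdf df0 f00; apply: (le_trans f00).
apply: (@ger0_derive1_le_cc R f 0 x); rewrite ?in_itv/= ?lexx ?x0//.
- by move=> y; rewrite in_itv/= => /andP[/ltW y0 _]; rewrite derive1E derive_val df0.
- apply: continuous_subspaceT => y; apply: differentiable_continuous.
  by apply/derivable1_diffP.
Qed.

Lemma cos_ge_1Bx x : 0 <= x -> 0 <= x - 1 + cos x.
Proof.
move=> x0; refine (@derive_ge0_ge0 (fun x => x - 1 + cos x)
  (fun x => 1 - sin x) x x0 _ _ _) => [y|y _|].
- by apply: is_derive_eq; rewrite subr0.
- by rewrite subr_ge0 sin_le1.
- by rewrite cos0; lra.
Qed.

Lemma le_sin_id x : 0 <= x -> 0 <= x - sin x.
Proof.
move=> x0; refine (@derive_ge0_ge0 (fun x => x - sin x)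
  (fun x => 1 - cos x) x x0 _ _ _) => [y _|].
- by rewrite subr_ge0 cos_le1.
- by rewrite sin0 subrr.
Qed.

Lemma cos_ge_taylor2 x : 0 <= x -> 0 <= cos x - 1 + x ^+ 2 / 2.
Proof.
move=> x0; refine (@derive_ge0_ge0 (fun x => cos x - 1 + x ^+ 2 / 2)
  (fun x => x - sin x) x x0 _ _ _) => [y|y|].
- by apply: is_derive_eq; rewrite /GRing.scale/=; lra.
- exact: le_sin_id.
- by rewrite cos0 expr0n/= mul0r; lra.
Qed.

Lemma sin_le_taylor3 x : 0 <= x -> 0 <= x ^+ 3 / 6 - x + sin x.
Proof.
move=> x0; refine (@derive_ge0_ge0 (fun x => x ^+ 3 / 6 - x + sin x)
  (fun x => cos x - 1 + x ^+ 2 / 2) x x0 _ _ _) => [y|y|].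
- by apply: is_derive_eq; rewrite /GRing.scale/=; lra.
- exact: cos_ge_taylor2.
- by rewrite sin0 expr0n/= mul0r; lra.
Qed.

Lemma sin_ge_taylor2 x : 0 <= x -> 0 <= x ^+ 2 / 2 - x + sin x.
Proof.
move=> x0; refine (@derive_ge0_ge0 (fun x => x ^+ 2 / 2 - x + sin x)
  (fun x => x - 1 + cos x) x x0 _ _ _) => [y|y|].
- by apply: is_derive_eq; rewrite /GRing.scale/=; lra.
- exact: cos_ge_1Bx.
- by rewrite sin0 expr0n/= mul0r; lra.
Qed.

Lemma cos_le_taylor3 x : 0 <= x -> 0 <= x ^+ 3 / 6 - (cos x - 1 + x ^+ 2 / 2).
Proof.
move=> x0; refine (@derive_ge0_ge0 (fun x => x ^+ 3 / 6 - (cos x - 1 + x ^+ 2 / 2))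
  (fun x => x ^+ 2 / 2 - x + sin x) x x0 _ _ _) => [y|y|].
- by apply: is_derive_eq; rewrite /GRing.scale/=; lra.
- exact: sin_ge_taylor2.
- by rewrite cos0 !expr0n/= !mul0r; lra.
Qed.

Lemma norm_cos_taylor x : `|cos x - 1 + x ^+ 2 / 2| <= `|x| ^+ 3 / 6.
Proof.
rewrite -(cos_norm x) -(real_normK (num_real x)).
have := cos_ge_taylor2 (normr_ge0 x); have := cos_le_taylor3 (normr_ge0 x).
move: `|x| => y h1 h2; rewrite ger0_norm//; lra.
Qed.

Lemma norm_sin_taylor x : `|sin x - x| <= `|x| ^+ 3 / 6.
Proof.
have h (y : R) : 0 <= y -> `|sin y - y| <= y ^+ 3 / 6.
  move=> y0; have := le_sin_id y0; have := sin_le_taylor3 y0.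
  by move=> h1 h2; rewrite ler0_norm; lra.
have [x0|x0] := leP 0 x; first by rewrite (ger0_norm x0) h.
have := h (- x); rewrite sinN -opprD normrN (ltr0_norm x0) => -> //; lra.
Qed.

(** Up to 2 the cubic Taylor bound gives [t ^+ 2 / 6]; from 2 to [pi] the cosine is negative while
    [t ^+ 2 <= 16], because [pi < 4]. *)
Lemma one_sub_cos_ge t : `|t| <= pi -> t ^+ 2 / 16 <= 1 - cos t.
Proof.
rewrite -(cos_norm t) -(real_normK (num_real t)).
move: (normr_ge0 t); move: `|t| => {}t t0 tpi.
have pi4 : pi < 4 :> R by have := @pihalf_lt2 R; lra.
have [t2|t2] := leP t 2.
  have h := cos_le_taylor3 t0.
  have : t ^+ 3 / 6 <= t ^+ 2 / 3.
    have := @ler_wpM2l R (t ^+ 2 / 6) _ _ _ t2.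
    by rewrite (exprS t 2) => /(_ (divr_ge0 (sqr_ge0 _) (ler0n _ _))); lra.
  have := sqr_ge0 t; lra.
have : cos t < cos 2 by rewrite ltr_cos// in_itv/= ?t0 ?tpi// ler0n; have := @pi_ge2 R.
have := @cos2_lt0 R; have : t ^+ 2 <= 16; last by lra.
by rewrite (_ : 16 = 4 ^+ 2) ?ler_pXn2r// ?nnegrE//; lra.
Qed.

(** Parallelogram identity: with z = exp(ix) and w = exp(iy), the right-hand side minus the
    left-hand side is |z + w - 2|^2 / 2. *)
Lemma one_sub_cosB x y :
  1 - cos (x - y) <= 2 * (1 - cos x) + 2 * (1 - cos y).
Proof.
rewrite cosB; have := cos2Dsin2 x; have := cos2Dsin2 y.
move: (cos x) (cos y) (sin x) (sin y) => a b c d h1 h2.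
have := sqr_ge0 (a + b - 2); have := sqr_ge0 (c + d); nra.
Qed.

End trigonometric_bounds.

(** * Characteristic functions of finitely supported masses *)

Section unit_complex.
Variable R : realType.
Implicit Types (x y t : R).

Definition cis x : R[i] := (cos x +i* sin x)%C.

Lemma cis0 : cis 0 = 1.
Proof. by rewrite /cis cos0 sin0. Qed.

Lemma cisD x y : cis (x + y) = cis x * cis y.
Proof. by rewrite /cis cosD sinD; congr (_ +i* _)%C; rewrite addrC. Qed.

Lemma cis_sum (I : Type) (r : seq I) (f : I -> R) :
  cis (\sum_(i <- r) f i) = \prod_(i <- r) cis (f i).
Proof. by rewrite (big_morph cis cisD cis0). Qed.

Lemma norm_cis x : `|cis x| = 1.
Proof. by rewrite normc_def/= cos2Dsin2 sqrtr1. Qed.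

Lemma norm_realc x : `|x%:C%C| = (`|x|)%:C%C :> R[i].
Proof. by rewrite normc_def/= expr0n/= addr0 sqrtr_sqr. Qed.

Lemma ReD (z w : R[i]) : complex.Re (z + w) = complex.Re z + complex.Re w.
Proof. by case: z; case: w. Qed.

Lemma Re_sum (I : Type) (r : seq I) (f : I -> R[i]) :
  complex.Re (\sum_(i <- r) f i) = \sum_(i <- r) complex.Re (f i).
Proof. by rewrite (big_morph _ ReD (erefl _)). Qed.

Lemma Re_realcM x (z : R[i]) : complex.Re (x%:C%C * z) = x * complex.Re z.
Proof. by case: z => a b; rewrite /= mul0r subr0. Qed.

Lemma norm_Re_le (z : R[i]) c : `|z| <= c%:C%C -> `|complex.Re z| <= c.
Proof.
rewrite normc_def lecR; apply: le_trans.
by rewrite -sqrtr_sqr ler_wsqrtr// lerDl sqr_ge0.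
Qed.

Lemma cis_taylor x :
  `|cis x - (1 - x ^+ 2 / 2)%:C%C - (0 +i* x)%C| <= (`|x| ^+ 3)%:C%C.
Proof.
rewrite normc_def lecR /= !subr0 opprB addrA addrAC -addrAC.
have h1 := norm_cos_taylor x; have h2 := norm_sin_taylor x.
rewrite -(ger0_norm (exprn_ge0 3 (normr_ge0 x))) -sqrtr_sqr ler_wsqrtr//.
rewrite -(real_normK (num_real (_ + _))) -(real_normK (num_real (_ - _))).
have -> : cos x + x ^+ 2 / 2 - 1 = cos x - 1 + x ^+ 2 / 2 by ring.
have e0 : 0 <= `|x| ^+ 3 by rewrite exprn_ge0.
have := normr_ge0 (cos x - 1 + x ^+ 2 / 2).
have := normr_ge0 (sin x - x).
move: h1 h2 e0; move: (`|x| ^+ 3) `|sin x - x| `|_ + _| => a b c h1 h2 a0 b0 c0.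
nra.
Qed.

Lemma cis_taylor0 x : `|cis x - 1| <= (2 * `|x|)%:C%C.
Proof.
rewrite normc_def lecR /= subr0.
have h1 : `|1 - cos x| <= `|x|.
  rewrite -cos_norm ger0_norm ?subr_ge0 ?cos_le1//.
  by have := cos_ge_1Bx (normr_ge0 x); lra.
have h2 : `|sin x| <= `|x|.
  have h (y : R) : 0 <= y -> `|sin y| <= y.
    move=> y0; have := le_sin_id y0; have := cos_ge_1Bx y0.
    have [y1|y1] := leP y 1; last by have := sin_max y; lra.
    have := sin_le_taylor3 y0 => h1' _ h2'.
    have : y ^+ 3 <= y.
      by rewrite exprS -[leRHS]mulr1 ler_wpM2l// expr_le1.
    by move=> y3; rewrite ger0_norm; lra.
  have [x0|x0] := leP 0 x; first by rewrite (ger0_norm x0) h.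
  by have := h (- x); rewrite sinN normrN (ltr0_norm x0) => -> //; lra.
rewrite -(ger0_norm (mulr_ge0 (ler0n _ 2) (normr_ge0 x))) -sqrtr_sqr ler_wsqrtr//.
rewrite distrC in h1.
rewrite -(real_normK (num_real (cos x - 1))) -(real_normK (num_real (sin x))).
have := normr_ge0 (cos x - 1); have := normr_ge0 (sin x).
move: h1 h2; move: `|x| `|sin x| `|_ - _| => a b c h1 h2 b0 c0.
nra.
Qed.

End unit_complex.

(** Comparing powers costs a factor equal to the exponent; this is why the truncation errors below
    have to be o(1/N). *)
Lemma norm_subXX (R : numDomainType) (z w : R) n : `|z| <= 1 -> `|w| <= 1 ->
  `|z ^+ n - w ^+ n| <= n%:R * `|z - w|.
Proof.
move=> z1 w1; elim: n => [|n IHn]; first by rewrite subrr normr0 mul0r.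
have -> : z ^+ n.+1 - w ^+ n.+1 = z ^+ n * (z - w) + (z ^+ n - w ^+ n) * w.
  by rewrite mulrBl mulrBr -!exprSr; ring.
rewrite (le_trans (ler_normD _ _))// !normrM -natr1 mulrDl mul1r addrC lerD//.
  by rewrite (le_trans _ IHn)// ler_piMr.
by rewrite ler_piMl// normrX exprn_ile1.
Qed.

Section finite_charfun.
Variables (R : realType) (I : finType) (p : I -> R).
Implicit Types (y : I -> R) (t : R) (N : nat).

Definition charfun y t : R[i] := \sum_i (p i)%:C%C * cis (t * y i).

Lemma charfun_shift y c t :
  charfun (fun i => y i - c) t = charfun y t * cis (- (t * c)).
Proof.
rewrite /charfun mulr_suml; apply: eq_bigr => i _.
by rewrite mulrBr cisD (mulrA _ (cis _)).
Qed.

(** Expanding the power over all functions [f] exhibits a finite trigonometric sum, which is visibly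
    continuous and can be integrated term by term. *)
Lemma Re_charfunX y t N e : complex.Re (charfun y t ^+ N * cis (- (t * e))) =
  \sum_(f : {ffun 'I_N -> I}) (\prod_j p (f j)) * cos (t * (\sum_j y (f j) - e)).
Proof.
rewrite -[N in _ ^+ N]card_ord -prodr_const.
rewrite (bigA_distr_bigA (fun (_ : 'I_N) i => (p i)%:C%C * cis (t * y i))).
rewrite mulr_suml Re_sum; apply: eq_bigr => f _.
rewrite big_split -cis_sum -(rmorph_prod (real_complex R)) -mulrA -cisD.
by rewrite Re_realcM -mulr_sumr mulrBr.
Qed.

Lemma norm_charfun_le y t : (forall i, 0 <= p i) ->
  `|charfun y t| <= (\sum_i p i)%:C%C.
Proof.
move=> p0; rewrite rmorph_sum/= (le_trans (ler_norm_sum _ _ _))//.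
by apply: ler_sum => i _; rewrite normrM norm_cis mulr1 norm_realc ger0_norm.
Qed.

(** The four errors are the cubic Taylor remainder, the missing mass, the off-centre mean and the
    deviation of the second moment from [v]: truncated weights satisfy the moment conditions only
    approximately. *)
Lemma charfun_taylor y t v : (forall i, 0 <= p i) ->
  `|charfun y t - (1 - v * t ^+ 2 / 2)%:C%C| <=
  (`|t| ^+ 3 * (\sum_i p i * `|y i| ^+ 3) + `|\sum_i p i - 1| +
   `|t| * `|\sum_i p i * y i| + t ^+ 2 / 2 * `|\sum_i p i * y i ^+ 2 - v|)%:C%C.
Proof.
move=> p0.
have -> : charfun y t - (1 - v * t ^+ 2 / 2)%:C%C =
    \sum_i (p i)%:C%C * (cis (t * y i) - (1 - (t * y i) ^+ 2 / 2)%:C%C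
                           - (0 +i* (t * y i))%C)
  + (\sum_i p i - 1)%:C%C + (t * \sum_i p i * y i)%:C%C * 'i%C
  - (t ^+ 2 / 2 * (\sum_i p i * y i ^+ 2 - v))%:C%C.
  have -> : \sum_i (p i)%:C%C * (cis (t * y i) - (1 - (t * y i) ^+ 2 / 2)%:C%C
      - (0 +i* (t * y i))%C) = charfun y t - (\sum_i p i)%:C%C
      + (t ^+ 2 / 2 * \sum_i p i * y i ^+ 2)%:C%C
      - (t * \sum_i p i * y i)%:C%C * 'i%C.
    rewrite !mulr_sumr !rmorph_sum/= mulr_suml -!sumrN -!big_split/=.
    apply: eq_bigr => i _; apply/eqP; rewrite eq_complex/= !mul0r !mulr0 !mulr1.
    by apply/andP; split; apply/eqP; field.
  rewrite !(rmorphB, rmorphM, rmorphD)/=; ring.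
have tri (z1 z2 z3 z4 : R[i]) a b c d : `|z1| <= a%:C%C -> `|z2| <= b%:C%C ->
    `|z3| <= c%:C%C -> `|z4| <= d%:C%C ->
    `|z1 + z2 + z3 - z4| <= (a + b + c + d)%:C%C.
  move=> h1 h2 h3 h4; rewrite (le_trans (ler_normB _ _))// rmorphD lerD//.
  rewrite (le_trans (ler_normD _ _))// rmorphD lerD//.
  by rewrite (le_trans (ler_normD _ _))// rmorphD lerD.
apply: tri.
- rewrite (le_trans (ler_norm_sum _ _ _))// mulr_sumr rmorph_sum.
  apply: ler_sum => i _; rewrite normrM norm_realc (ger0_norm (p0 i)).
  have -> : `|t| ^+ 3 * (p i * `|y i| ^+ 3) = p i * (`|t| ^+ 3 * `|y i| ^+ 3).
    by ring.
  rewrite [leRHS]rmorphM ler_wpM2l ?ler0c//.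
  by rewrite (le_trans (cis_taylor _))// normrM exprMn.
- by rewrite norm_realc.
- rewrite normrM norm_realc [X in _ * X](_ : _ = 1) ?mulr1 ?normrM//.
  by rewrite normc_def/= expr0n/= expr1n add0r sqrtr1.
- by rewrite norm_realc lecR normrM ger0_norm// divr_ge0 ?sqr_ge0.
Qed.

(* Separating the atom at [i0] from the rest makes the modulus of the rest at most
   its mass, so only the real part of the rest can reach the total mass. *)
Lemma sqr_norm_charfun_le y t i0 : (forall i, 0 <= p i) -> y i0 = 0 ->
  `|charfun y t| ^+ 2 <= ((\sum_i p i) ^+ 2 -
    2 * p i0 * \sum_i p i * (1 - cos (t * y i)))%:C%C.
Proof.
move=> p0 y0; set W := \sum_i p i.
pose psi : R[i] := \sum_(i | i != i0) (p i)%:C%C * cis (t * y i).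
have cE : charfun y t = (p i0)%:C%C + psi.
  by rewrite /charfun (bigD1 i0)//= y0 mulr0 cis0 mulr1.
have WE : W - p i0 = \sum_(i | i != i0) p i.
  by rewrite /W (bigD1 i0)//= addrAC subrr add0r.
have psi_le : `|psi| <= (W - p i0)%:C%C.
  rewrite WE rmorph_sum/=.
  rewrite (le_trans (ler_norm_sum _ _ _))//.
  by apply: ler_sum => i _; rewrite normrM norm_cis mulr1 norm_realc ger0_norm.
have W0 : 0 <= W - p i0 by rewrite -ler0c (le_trans _ psi_le).
have Re_psi : complex.Re psi = W - p i0 - \sum_i p i * (1 - cos (t * y i)).
  rewrite (bigD1 i0)//= y0 mulr0 cos0 subrr mulr0 add0r.
  rewrite WE -sumrB /psi (big_morph _ (@ReD R) (erefl _)).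
  by apply: eq_bigr => i _; rewrite Re_realcM/=; ring.
rewrite cE -add_Re2_Im2 lecR.
have : complex.Re psi ^+ 2 + complex.Im psi ^+ 2 <= (W - p i0) ^+ 2.
  rewrite -lecR add_Re2_Im2 rmorphXn/= lerXn2r ?nnegrE//.
  by rewrite ler0c.
move: Re_psi; case: psi {cE psi_le} => a b /= -> ; rewrite add0r.
move: (\sum_i p i * _) (p i0) => Q q; nra.
Qed.

End finite_charfun.

(** * Fourier inversion and the local limit theorem *)

Lemma cvg_sum_seq (T I : Type) (F : set_system T) (R : realType) (r : seq I)
    (f : I -> T -> R) (a : I -> R) : Filter F ->
  (forall i, f i @ F --> a i) ->
  (fun x => \sum_(i <- r) f i x) @ F --> \sum_(i <- r) a i.
Proof.
move=> FF fa; elim: r => [|i r IHr].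
  by rewrite big_nil; under eq_cvg do rewrite big_nil; exact: cvg_cst.
by rewrite big_cons; under eq_cvg do rewrite big_cons; exact: cvgD.
Qed.

Section gaussian_limit.
Variable R : realType.
Local Notation mu := (@lebesgue_measure R).

Lemma gauss_integral (c : R) : 0 < c ->
  mu.-integrable setT (fun x => (expR (- c * x ^+ 2))%:E) /\
  (\int[mu]_x (expR (- c * x ^+ 2))%:E = (Num.sqrt (pi / c))%:E)%E.
Proof.
(* [s] is the standard deviation and [k] the factor for which the integrand is [k] times a normal
   density. *)
move=> c0; pose s := (Num.sqrt (2 * c))^-1; pose k := Num.sqrt (pi / c).
have c2 : 0 < 2 * c by rewrite mulr_gt0.
have s0 : s != 0 by rewrite invr_neq0// gt_eqF// sqrtr_gt0.
have s2 : s ^+ 2 *+ 2 = c^-1.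
  rewrite /s exprVn sqr_sqrtr ?ltW// -mulr_natr invfM mulrAC mulVf ?mul1r//.
have k0 : k != 0 by rewrite gt_eqF// sqrtr_gt0 divr_gt0// pi_gt0.
have E : (fun x : R => (expR (- c * x ^+ 2))%:E) =
         (fun x => k%:E * (normal_pdf 0 s x)%:E)%E.
  apply/funext => x; rewrite normal_pdfE// /normal_peak /normal_fun.
  rewrite -EFinM (mulrA k) -[X in Num.sqrt X]mulrnAl s2 (mulrC c^-1) -/k.
  by rewrite divff// mul1r subr0 invrK mulrC mulrN mulNr.
rewrite E; split.
  by apply: integrableZl => //; exact: integrable_normal_pdf.
rewrite integralZl//; last exact: integrable_normal_pdf.
by rewrite integral_normal_pdf mule1.
Qed.

Lemma cvg_gauss_integral (G : nat -> R -> R) (s : nat -> R) (c v : R) :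
  0 < c -> 0 < v -> s @ \oo --> +oo -> (forall N, continuous (G N)) ->
  (\forall N \near \oo, forall x, `|x| <= s N ->
     `|G N x| <= expR (- c * x ^+ 2)) ->
  (forall x, G ^~ x @ \oo --> expR (- (v / 2) * x ^+ 2)) ->
  (fun N => \int[mu]_(x in `[- s N, s N]) (G N x)) @ \oo -->
    Num.sqrt (2 * pi / v).
Proof.
move=> c0 v0 soo Gcont [N0 _ Gle] Gcvg.
pose f N x := (G N \_ `[- s N, s N]) x.
have mf N : measurable_fun setT (f N).
  apply/(measurable_restrict _ (measurable_itv _)) => //.
  by rewrite setTI; apply: measurable_funTS; exact: continuous_measurable_fun.
have [gint gval] := gauss_integral (c := v / 2) (divr_gt0 v0 (ltr0n _ 2)).
have [cint _] := gauss_integral c0.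
have fcvg x : f ^~ x @ \oo --> expR (- (v / 2) * x ^+ 2).
  apply: cvg_trans (Gcvg x); apply: near_eq_cvg.
  have : \forall N \near \oo, `|x| <= s N by have /cvgryPge := soo; apply.
  apply: filterS => N xs; rewrite /f /patch mem_set//=.
  by rewrite in_itv/= -ler_norml.
(* The domination holds only from [N0] on, whereas dominated convergence asks for it at every
   index. *)
rewrite -(cvg_shiftn N0).
have := @dominated_convergence _ _ R mu setT measurableT
  (fun N x => (f (N + N0)%N x)%:E) (fun x => (expR (- (v / 2) * x ^+ 2))%:E)
  (fun x => (expR (- c * x ^+ 2))%:E).
case.
- by move=> N; apply: measurableT_comp; [exact: EFin_measurable|exact: mf].
- exact: measurable_int gint.
- apply: aeW => x _; apply: cvg_EFin; first by near=> N.
  by rewrite (cvg_shiftn N0 (f ^~ x)); exact: fcvg.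
- exact: cint.
- apply: aeW => x N _; rewrite lee_fin /f /patch.
  case: ifPn => [|_]; last by rewrite normr0 expR_ge0.
  by rewrite inE/= in_itv/= -ler_norml; apply: Gle => /=; rewrite leq_addl.
move=> _ _; rewrite gval => /fine_cvg/=.
rewrite (_ : pi / (v / 2) = 2 * pi / v); last by field; rewrite gt_eqF.
apply: cvg_trans; apply: near_eq_cvg; apply: nearW => N /=.
rewrite /Rintegral [in RHS]integral_mkcond; congr fine.
by apply: eq_integral => x _; rewrite /f /patch; case: ifP.
Unshelve. all: by end_near. Qed.

Lemma continuous_cosM (c : R) : continuous (fun x : R => cos (x * c)).
Proof.
move=> x; apply: continuous_comp; last exact: continuous_cos.
exact: mulrr_continuous.
Qed.

Lemma continuous_sum_cos (I : finType) (a b : I -> R) :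
  continuous (fun x : R => \sum_i a i * cos (x * b i)).
Proof.
by move=> x; apply: cvg_sum_seq => i; apply: cvgMl_tmp; exact: continuous_cosM.
Qed.

Lemma integral_sum_cos (I : finType) (a b : I -> R) (s : R) :
  \int[mu]_(x in `[- s, s]) (\sum_i a i * cos (x * b i)) =
  \sum_i a i * \int[mu]_(x in `[- s, s]) cos (x * b i).
Proof.
have cint (f : R -> R) : continuous f -> mu.-integrable `[- s, s] (EFin \o f).
  move=> fc; apply: continuous_compact_integrable; first exact: segment_compact.
  exact: continuous_subspaceT.
have cs r : continuous (fun x : R => \sum_(i <- r) a i * cos (x * b i)).
  by move=> x; apply: cvg_sum_seq => i; apply: cvgMl_tmp; exact: continuous_cosM.
elim: (index_enum I) => [|i r IHr].
  under eq_Rintegral do rewrite big_nil.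
  by rewrite big_nil Rintegral_cst// mul0r.
under eq_Rintegral do rewrite big_cons.
rewrite big_cons RintegralD//; last 2 first.
- by apply: cint => x; apply: cvgMl_tmp; exact: continuous_cosM.
- by apply: cint; exact: cs.
by rewrite IHr RintegralZl//; apply: cint; exact: continuous_cosM.
Qed.

Lemma sin_pi_int (k : int) : sin (pi * k%:~R) = 0 :> R.
Proof.
have h (n : nat) : sin (pi * n%:R) = 0 :> R.
  by have := alternatingn (@sinDpi R) n 0; rewrite sin0 mulr0 add0r mulr_natr.
case: k => n; first exact: h.
by rewrite NegzE mulrNz mulrN sinN h oppr0.
Qed.

(** Orthogonality of characters on a period stretched by [s]. *)
Lemma integral_cos_int (s : R) (k : int) : 0 < s ->
  \int[mu]_(x in `[- (pi * s), pi * s]) cos (x / s * k%:~R) =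
  if k == 0 then 2 * pi * s else 0.
Proof.
move=> s0; have ps : 0 < pi * s by rewrite mulr_gt0// pi_gt0.
have pps : - (pi * s) < pi * s by lra.
have [->|k0] := eqVneq.
  under eq_Rintegral do rewrite mulr0z mulr0 cos0.
  rewrite Rintegral_cst// mul1r.
  transitivity (fine ((pi * s)%:E - (- (pi * s))%:E)%E); last by rewrite /=; ring.
  congr fine; have := @lebesgue_measure_itv R `[- (pi * s), pi * s]%R.
  by rewrite /= lte_fin pps.
have kR : k%:~R != 0 :> R by rewrite intr_eq0.
pose F (x : R) := s / k%:~R * sin (x / s * k%:~R).
have dF (x : R) : is_derive x 1 F (cos (x / s * k%:~R)).
  apply: is_derive_eq; rewrite /GRing.scale/=; field.
  by rewrite kR gt_eqF.
have cF : continuous F.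
  by move=> x; apply: differentiable_continuous; apply/derivable1_diffP.
rewrite /Rintegral (@continuous_FTC2 R _ F)//.
- rewrite -EFinB /= /F.
  have e1 : pi * s / s * k%:~R = pi * k%:~R :> R by rewrite mulfK// gt_eqF.
  by rewrite mulNr mulNr e1 sinN sin_pi_int; ring.
- have -> : (fun x => cos (x / s * k%:~R)) = (fun x => cos (x * (s^-1 * k%:~R))).
    by apply/funext => x; rewrite mulrA.
  by apply: continuous_subspaceT; exact: continuous_cosM.
- split; [by move=> x _|exact/cvg_at_right_filter/cF|exact/cvg_at_left_filter/cF].
- by move=> x _; rewrite derive1E derive_val.
Qed.

(** Fourier inversion: integrating the expansion [Re_charfunX] over a full period keeps exactly the
    [f] whose sum is [e]. The scale [s] will be the square root of [N]. *)
Lemma charfun_fourier (I : finType) (p : I -> R) (n : I -> nat) (s : R) N e :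
  0 < s ->
  \int[mu]_(x in `[- (pi * s), pi * s])
    complex.Re (charfun p (fun i => (n i)%:R) (x / s) ^+ N *
      cis (- (x / s * e%:R))) =
  2 * pi * s * \sum_(f : {ffun 'I_N -> I} | (\sum_j n (f j))%N == e) \prod_j p (f j).
Proof.
move=> s0.
pose k (f : {ffun 'I_N -> I}) := (\sum_j n (f j))%N%:Z - e%:Z.
transitivity (\int[mu]_(x in `[- (pi * s), pi * s])
  (\sum_(f : {ffun 'I_N -> I}) (\prod_j p (f j)) * cos (x * (s^-1 * (k f)%:~R)))).
  apply: eq_Rintegral => x _; rewrite Re_charfunX; apply: eq_bigr => f _.
  by rewrite mulrA /k rmorphB/= -!pmulrn natr_sum.
rewrite integral_sum_cos mulr_sumr [RHS]big_mkcond/=; apply: eq_bigr => f _.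
under eq_Rintegral do rewrite mulrA.
rewrite integral_cos_int// /k subr_eq0 eqz_nat.
by case: ifP => _; rewrite ?mulr0// mulrC.
Qed.

End gaussian_limit.

(** * Elementary limits along the integers *)

Section sequence_limits.
Variable R : realType.

Lemma cvg_dist_le (f b : nat -> R) (l : R) :
  (\forall N \near \oo, `|f N - l| <= b N) -> b @ \oo --> 0 -> f @ \oo --> l.
Proof.
move=> fb b0; apply/cvgrPdist_le => e e0.
have /cvgr0Pnorm_le/(_ e e0) := b0; apply: filterS2 fb => N fN bN.
by rewrite distrC (le_trans fN)// (le_trans (ler_norm _)).
Qed.

Lemma cvg_sqrtn : (fun N : nat => Num.sqrt N%:R : R) @ \oo --> +oo.
Proof.
apply/cvgryPge => A; have /cvgryPge/(_ (A ^+ 2)) := @cvgr_idn R.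
apply: filterS => N AN; rewrite (le_trans (ler_norm A))// -sqrtr_sqr.
by rewrite ler_wsqrtr.
Qed.

Lemma cvg_inv_sqrtn : (fun N : nat => (Num.sqrt N%:R)^-1 : R) @ \oo --> 0.
Proof.
apply/gtr0_cvgV0; last exact: cvg_sqrtn.
by near=> N; rewrite sqrtr_gt0 ltr0n; near: N; exists 1%N.
Unshelve. all: by end_near. Qed.

(** The exponential lies between [1 - a] and [(1 + a)^-1], and the latter is at most
    [1 - a + a ^+ 2]. *)
Lemma expRN_taylor (a : R) : 0 <= a -> `|expR (- a) - (1 - a)| <= a ^+ 2.
Proof.
move=> a0; have h1 := expR_ge1Dx (- a).
have h2 : expR (- a) <= (1 + a)^-1.
  by rewrite expRN lef_pV2 ?posrE ?expR_gt0 ?expR_ge1Dx// ltr_wpDr.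
have h3 : (1 + a)^-1 <= 1 - a + a ^+ 2.
  have a1 : 0 < 1 + a by rewrite ltr_wpDr.
  rewrite -[leLHS]mul1r ler_pdivrMr//.
  have -> : (1 - a + a ^+ 2) * (1 + a) = 1 + a ^+ 3 by ring.
  by rewrite lerDl exprn_ge0.
by rewrite ger0_norm; lra.
Qed.

End sequence_limits.

(** * Local limit theorem for triangular arrays of finite masses *)

Section local_limit.
Variables (R : realType) (I : nat -> finType) (p : forall N, I N -> R).
Variables (n : forall N, I N -> nat) (m : nat -> R) (e : nat -> nat).
Variables (v c K : R).
Arguments p : clear implicits.
Arguments n : clear implicits.
Hypotheses (c0 : 0 < c) (v0 : 0 < v) (p0 : forall N i, 0 <= p N i).
Hypothesis p1 : forall N, \sum_i p N i <= 1.
Hypothesis mass : (fun N => N%:R * `|\sum_i p N i - 1|) @ \oo --> (0 : R).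
Hypothesis centered :
  (fun N => N%:R * `|\sum_i p N i * ((n N i)%:R - m N)|) @ \oo --> (0 : R).
Hypothesis variance :
  (fun N => \sum_i p N i * ((n N i)%:R - m N) ^+ 2) @ \oo --> v.
Hypothesis third_moment :
  \forall N \near \oo, \sum_i p N i * `|(n N i)%:R - m N| ^+ 3 <= K.
Hypothesis charfun_decay : \forall N \near \oo, forall t, `|t| <= pi ->
  `|charfun (p N) (fun i => (n N i)%:R) t| ^+ 2 <= (1 - 2 * c * t ^+ 2)%:C%C.
Hypothesis shift : \forall N \near \oo, `|N%:R * m N - (e N)%:R| <= K.

Let s N : R := Num.sqrt N%:R.
(** The integrand of Fourier inversion at the scaled frequency [x / s N]. *)
Let G N x := complex.Re (charfun (p N) (fun i => (n N i)%:R) (x / s N) ^+ N *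
  cis (- (x / s N * (e N)%:R))).

Let s2 N : s N ^+ 2 = N%:R. Proof. by rewrite sqr_sqrtr. Qed.

Let s_gt0 N : (0 < N)%N -> 0 < s N. Proof. by rewrite sqrtr_gt0 ltr0n. Qed.

Let G_continuous N : continuous (G N).
Proof.
rewrite (_ : G N = (fun x => \sum_(f : {ffun 'I_N -> I N}) (\prod_j p N (f j)) *
    cos (x * ((s N)^-1 * (\sum_j (n N (f j))%:R - (e N)%:R))))).
  exact: continuous_sum_cos.
apply/funext => x; rewrite /G Re_charfunX; apply: eq_bigr => f _.
by rewrite mulrA.
Qed.

(** The squared modulus is at most [1 - 2 * c * t ^+ 2], hence at most [expR (- 2 * c * t ^+ 2)];
    the power [N] replaces [t ^+ 2] by [N%:R * t ^+ 2 = x ^+ 2]. *)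
Let G_dominated : \forall N \near \oo, forall x, `|x| <= pi * s N ->
  `|G N x| <= expR (- c * x ^+ 2).
Proof.
near=> N => x xs; have N0 : (0 < N)%N by near: N; exists 1%N.
have sN0 := s_gt0 N0.
have tpi : `|x / s N| <= pi by rewrite normrM normfV (gtr0_norm sN0) ler_pdivrMr.
have decay : forall t, `|t| <= pi ->
  `|charfun (p N) (fun i => (n N i)%:R) t| ^+ 2 <= (1 - 2 * c * t ^+ 2)%:C%C.
  by near: N; exact: charfun_decay.
apply: norm_Re_le; rewrite normrM norm_cis mulr1 normrX.
have -> : expR (- c * x ^+ 2) = expR (- c * (x / s N) ^+ 2) ^+ N.
  rewrite -expRM_natl exprMn exprVn s2; congr expR; field.
  by rewrite pnatr_eq0 -lt0n.
rewrite rmorphXn/= ler_pXn2r ?nnegrE ?normr_ge0 ?ler0c ?expR_ge0//.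
rewrite -(@ler_pXn2r _ 2%N) ?nnegrE ?normr_ge0 ?ler0c ?expR_ge0//.
rewrite (le_trans (decay _ tpi))// -rmorphXn lecR -expRM_natl.
by rewrite (le_trans _ (expR_ge1Dx _))// !mulrA; lra.
Unshelve. all: by end_near. Qed.

(** By [norm_subXX] the powers of the characteristic function and of the Gaussian factor differ by
    at most [N] times the error between the bases at [t = x / s N]. That is why [mass] and
    [centered] carry a factor [N], while the variance, multiplied by [t ^+ 2], only has to
    converge. *)
Let G_cvg x : G ^~ x @ \oo --> expR (- (v / 2) * x ^+ 2).
Proof.
(* In order: the phase left by the shift together with the cubic remainder, the missing mass, the
   off-centre mean, the variance error, and the second-order error of the exponential. *)
pose b N := (2 * `|x| * K + `|x| ^+ 3 * K) * (s N)^-1 +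
  N%:R * `|\sum_i p N i - 1| +
  `|x| * (N%:R * `|\sum_i p N i * ((n N i)%:R - m N)|) +
  x ^+ 2 / 2 * `|\sum_i p N i * ((n N i)%:R - m N) ^+ 2 - v| +
  v ^+ 2 * x ^+ 4 * ((s N)^-1 * (s N)^-1).
apply: (@cvg_dist_le _ _ b); last first.
  have -> : 0 = (2 * `|x| * K + `|x| ^+ 3 * K) * 0 + 0 + `|x| * 0 +
      x ^+ 2 / 2 * 0 + v ^+ 2 * x ^+ 4 * (0 * 0) :> R by ring.
  apply: cvgD; [apply: cvgD; [apply: cvgD; [apply: cvgD|]|]|].
  - by apply: cvgMl_tmp; exact: cvg_inv_sqrtn.
  - exact: mass.
  - by apply: cvgMl_tmp; exact: centered.
  - apply: cvgMl_tmp.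
    have /cvg_norm : (fun N => \sum_i p N i * ((n N i)%:R - m N) ^+ 2 - v)
      @ \oo --> v - v by apply: cvgB; [exact: variance|exact: cvg_cst].
    by rewrite subrr normr0.
  - by apply: cvgMl_tmp; apply: cvgM; exact: cvg_inv_sqrtn.
near=> N; have N0 : (0 < N)%N by near: N; exists 1%N.
have K3 : \sum_i p N i * `|(n N i)%:R - m N| ^+ 3 <= K.
  by near: N; exact: third_moment.
have Ke : `|N%:R * m N - (e N)%:R| <= K by near: N; exact: shift.
have sN0 := s_gt0 N0; have sn0 : s N != 0 by rewrite gt_eqF.
set t := x / s N; pose y i : R := (n N i)%:R - m N.
have t2 : N%:R * t ^+ 2 = x ^+ 2 by rewrite -s2 /t; field.
set z := charfun (p N) y t; pose w := expR (- (v / 2 * t ^+ 2)).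
(* Centring by [m N] leaves the phase [t * (N%:R * m N - (e N)%:R)], which is small because of
   [shift]. *)
have GE : G N x = complex.Re (z ^+ N * cis (t * (N%:R * m N - (e N)%:R))).
  rewrite /G -/t /z charfun_shift exprMn -(mulrA (_ ^+ N)); congr (complex.Re (_ * _)).
  have -> : cis (- (t * m N)) ^+ N = cis (- (t * (N%:R * m N))).
    rewrite -[N in _ ^+ N]card_ord -prodr_const -cis_sum sumr_const card_ord.
    by congr cis; rewrite -mulr_natl; ring.
  by rewrite -cisD; congr cis; ring.
have wE : expR (- (v / 2) * x ^+ 2) = w ^+ N.
  by rewrite /w -expRM_natl -t2; congr expR; ring.
have z1 : `|z| <= 1.
  by rewrite (le_trans (norm_charfun_le _ _ (@p0 N)))// (lecR _ 1) p1.
have w1 : `|w%:C%C| <= 1 :> R[i].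
  rewrite norm_realc (lecR _ 1) ger0_norm ?expR_ge0// expR_le1.
  by rewrite oppr_le0 mulr_ge0 ?sqr_ge0// divr_ge0// ltW.
have -> : G N x - expR (- (v / 2) * x ^+ 2) =
    complex.Re (z ^+ N * cis (t * (N%:R * m N - (e N)%:R)) - (w%:C%C) ^+ N).
  by rewrite GE wE ReD -rmorphXn.
apply: norm_Re_le.
have -> : z ^+ N * cis (t * (N%:R * m N - (e N)%:R)) - (w%:C%C) ^+ N =
    z ^+ N * (cis (t * (N%:R * m N - (e N)%:R)) - 1) + (z ^+ N - w%:C%C ^+ N).
  by ring.
rewrite (le_trans (ler_normD _ _))//.
pose b1 := 2 * `|t * (N%:R * m N - (e N)%:R)|.
have h1 : `|z ^+ N * (cis (t * (N%:R * m N - (e N)%:R)) - 1)| <= b1%:C%C.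
  rewrite normrM (le_trans _ (cis_taylor0 _))// ler_piMl// normrX.
  by rewrite exprn_ile1.
pose b2 := `|t| ^+ 3 * (\sum_i p N i * `|y i| ^+ 3) + `|\sum_i p N i - 1| +
   `|t| * `|\sum_i p N i * y i| + t ^+ 2 / 2 * `|\sum_i p N i * y i ^+ 2 - v|.
have h2 : `|z ^+ N - w%:C%C ^+ N| <= (N%:R * (b2 + (v / 2 * t ^+ 2) ^+ 2))%:C%C.
  rewrite (le_trans (norm_subXX _ z1 w1))// rmorphM rmorph_nat ler_wpM2l//.
  have -> : z - w%:C%C = (z - (1 - v * t ^+ 2 / 2)%:C%C)
      - (w - (1 - v / 2 * t ^+ 2))%:C%C.
    by rewrite !(rmorphB, rmorphM)/=; ring.
  rewrite (le_trans (ler_normB _ _))// [leRHS]rmorphD lerD//.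
    by apply: charfun_taylor; exact: p0.
  rewrite norm_realc lecR expRN_taylor// mulr_ge0 ?sqr_ge0//.
  by rewrite divr_ge0// ltW.
rewrite (le_trans (lerD h1 h2))// -rmorphD lecR /b.
have tE : `|t| = `|x| * (s N)^-1 by rewrite normrM normfV (gtr0_norm sN0).
have s1 : 1 <= s N by rewrite -sqrtr1 ler_wsqrtr// ler1n.
have hb1 : b1 <= 2 * `|x| * K * (s N)^-1.
  rewrite /b1 normrM tE.
  rewrite (_ : 2 * `|x| * K * _ = 2 * (`|x| * (s N)^-1 * K)); last by ring.
  by rewrite !ler_wpM2l// mulr_ge0// invr_ge0 ltW.
have hb2 : N%:R * (`|t| ^+ 3 * (\sum_i p N i * `|y i| ^+ 3)) <=
    `|x| ^+ 3 * K * (s N)^-1.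
  rewrite tE -s2.
  rewrite (_ : s N ^+ 2 * _ = `|x| ^+ 3 * (\sum_i p N i * `|y i| ^+ 3) * (s N)^-1).
    by rewrite ler_wpM2r ?invr_ge0 ?(ltW sN0)// ler_wpM2l// exprn_ge0.
  by field.
have hb3 : N%:R * (`|t| * `|\sum_i p N i * y i|) <=
    `|x| * (N%:R * `|\sum_i p N i * y i|).
  rewrite mulrCA ler_wpM2r ?mulr_ge0// tE ler_piMr// invf_le1//.
have hb4 : N%:R * (t ^+ 2 / 2 * `|\sum_i p N i * y i ^+ 2 - v|) =
    x ^+ 2 / 2 * `|\sum_i p N i * y i ^+ 2 - v|.
  by rewrite -t2; ring.
have hb5 : N%:R * (v / 2 * t ^+ 2) ^+ 2 <= v ^+ 2 * x ^+ 4 * ((s N)^-1 * (s N)^-1).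
  rewrite -s2 /t (_ : s N ^+ 2 * _ = 4^-1 * (v ^+ 2 * x ^+ 4 * ((s N)^-1 * (s N)^-1))).
    rewrite ler_piMl ?invf_le1 ?ler1n// mulr_ge0//.
    by rewrite mulr_ge0 ?sqr_ge0// (_ : x ^+ 4 = (x ^+ 2) ^+ 2) ?sqr_ge0// -exprM.
    by rewrite mulr_ge0// invr_ge0 ltW.
  by field.
rewrite /b2 !mulrDr hb4 mulrDl.
move: hb1 hb2 hb3 hb5; rewrite /y; lra.
Unshelve. all: by end_near. Qed.

Lemma local_limit :
  (fun N => Num.sqrt N%:R *
    \sum_(f : {ffun 'I_N -> I N} | (\sum_j n N (f j))%N == e N) \prod_j p N (f j))
  @ \oo --> (Num.sqrt (2 * pi * v))^-1.
Proof.
have pi0 : 0 < pi :> R := @pi_gt0 R.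
have -> : (Num.sqrt (2 * pi * v))^-1 = (2 * pi)^-1 * Num.sqrt (2 * pi / v).
  have q0 : 0 < 2 * pi :> R by rewrite mulr_gt0.
  rewrite sqrtrM ?ltW// [in RHS]sqrtrM ?(ltW q0)// sqrtrV ?ltW//.
  rewrite -{2}(sqr_sqrtr (ltW q0)); field.
  by rewrite !gt_eqF// sqrtr_gt0.
have spoo : (fun N => pi * s N) @ \oo --> +oo.
  apply/cvgryPge => A; have /cvgryPge/(_ (A / pi)) := @cvg_sqrtn R.
  by apply: filterS => N; rewrite ler_pdivrMr// mulrC.
have lim := cvg_gauss_integral c0 v0 spoo G_continuous G_dominated G_cvg.
apply: (cvg_trans _ (cvgMl_tmp (a := (2 * pi)^-1) lim)); apply: near_eq_cvg; near=> N => /=.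
rewrite charfun_fourier; last by apply: s_gt0; near: N; exists 1%N.
by rewrite -(mulrA (2 * pi)) mulKf// mulf_neq0// gt_eqF.
Unshelve. all: by end_near. Qed.

End local_limit.

(** * Counting shells inside a finite set *)

Section shell_counting.
Variables (R : realType) (T : choiceType) (H : T -> R) (h : R) (n : T -> nat).
Hypotheses (h0 : 0 < h) (Hn : forall x, H x = h * (n x)%:R).

Lemma total_energy_deg N (x : N.-tuple T) :
  total_energy H x = h * (\sum_i n (tnth x i))%:R.
Proof. by rewrite natr_sum mulr_sumr; apply: eq_bigr => i _; rewrite Hn. Qed.

Lemma shellE N e (x : N.-tuple T) :
  shell H (h * e%:R) x <-> (\sum_i n (tnth x i))%N = e.
Proof.
rewrite /shell/= total_energy_deg; split => [|->//].
by move=> /(mulfI (negbT (gt_eqF h0)))/eqP; rewrite eqr_nat => /eqP.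
Qed.

Section truncation.
Variables (N e : nat) (F : {fset T}).
Hypothesis FP : forall x, (n x <= e)%N -> x \in F.

Let tuple_of (f : {ffun 'I_N -> F}) : N.-tuple T := [tuple val (f i) | i < N].

Let tuple_of_inj : injective tuple_of.
Proof.
move=> f g fg; apply/ffunP => i; apply: val_inj.
by have := congr1 (fun t => tnth t i) fg; rewrite !tnth_mktuple.
Qed.

(** Degrees are natural numbers, so no coordinate of a shell point has degree above [e]: all
    coordinates lie in [F], and the truncation loses no point. *)
Let shell_image : @shell R T H N (h * e%:R) =
  [set` [fset tuple_of f | f in
          [pred f : {ffun 'I_N -> F} | (\sum_i n (val (f i)))%N == e]]%fset].
Proof.
apply/seteqP; split => x /=.
  move=> /shellE xe; have xF i : tnth x i \in F.
    by apply: FP; rewrite -xe (bigD1 i)//= leq_addr.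
  pose f := [ffun i => [` xF i]%fset].
  have fx : tuple_of f = x.
    by apply: eq_from_tnth => i; rewrite tnth_mktuple ffunE.
  apply/imfsetP; exists f => //; apply/eqP; rewrite -[RHS]xe.
  by apply: eq_bigr => i _; rewrite ffunE.
move=> /imfsetP[f /= /eqP fe ->]; apply/shellE; rewrite -[RHS]fe.
by apply: eq_bigr => i _; rewrite tnth_mktuple.
Qed.

Lemma shell_card_ffun : shell_card H N (h * e%:R) =
  #|[pred f : {ffun 'I_N -> F} | (\sum_i n (val (f i)))%N == e]|.
Proof. by rewrite /shell_card shell_image set_fsetK card_imfset// cardE. Qed.

Lemma finite_shell : finite_set (@shell R T H N (h * e%:R)).
Proof. by rewrite shell_image; exact: finite_fset. Qed.

(** The product Gibbs weight depends only on the total energy, hence is constant on the shell. *)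
Lemma sum_prod_gibbs b :
  \sum_(f : {ffun 'I_N -> F} | (\sum_j n (val (f j)))%N == e)
    \prod_j gibbs H b (val (f j)) =
  (shell_card H N (h * e%:R))%:R * expR (- b * (h * e%:R)) / partition_fun H b ^+ N.
Proof.
rewrite shell_card_ffun -mulrA -sum1_card natr_sum mulr_suml.
apply: eq_big => // f /eqP fe; rewrite mul1r.
rewrite big_split/= prodr_const card_ord -expR_sum -mulr_sumr mulrC exprVn.
congr (expR (_ * _) / _); rewrite -fe natr_sum mulr_sumr.
by apply: eq_bigr => i _; rewrite Hn.
Qed.

End truncation.
End shell_counting.

(** * Local limit theorem for energy shells *)

Section shell_local_limit.
Variables (R : realType) (T : choiceType) (H : T -> R) (h : R) (n : T -> nat).
Variables (x0 x1 : T) (F0 : {fset T}) (C : R).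
Hypotheses (h0 : 0 < h) (Hn : forall x, H x = h * (n x)%:R).
Hypothesis Zs : forall b, 0 < b -> nnsummable (fun x => expR (- b * H x)).
Hypotheses (Hx0 : H x0 = 0) (Hx1 : 0 < H x1) (C0 : 0 < C).
Hypothesis aperiodic :
  forall t, 1 - cos t <= C * \sum_(x <- F0) (1 - cos (t * (n x)%:R)).

Let H0 x : 0 <= H x. Proof. by rewrite Hn mulr_ge0// ltW. Qed.

Let nH x : (n x)%:R = H x / h. Proof. by rewrite Hn mulrAC divff ?mul1r// gt_eqF. Qed.

Let gibbs_ge0 b x : 0 < b -> 0 <= gibbs H b x.
Proof. by move=> b0; rewrite mulr_ge0 ?expR_ge0// invr_ge0 ltW// (partition_fun_gt0 Zs x0). Qed.

Let nmean b := mean_energy H b / h.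

Let deg_moment j b : 0 < b ->
  nnsummable (fun x => (n x)%:R ^+ j * gibbs H b x) /\
  rsum (fun x => (n x)%:R ^+ j * gibbs H b x) =
    (h ^+ j)^-1 * (moment H j b / partition_fun H b).
Proof.
move=> b0; have [s e] := nnsummable_gibbs Zs b0 x0 (nnsummable_moment H0 Zs j b0).
rewrite -e (_ : (fun x => _ * gibbs H b x) =
    fun x => (h ^+ j)^-1 * (H x ^+ j * gibbs H b x)).
  by apply: nnsummableZ => //; rewrite invr_ge0 exprn_ge0 ?ltW.
by apply/funext => x; rewrite nH exprMn exprVn; ring.
Qed.

(** The raw moments of orders 0, 1 and 2 are approximated simultaneously on one finite set, then
    recombined into centred ones. The first three bounds improve with [d]; the last two are uniform
    in it. *)
Let window b (e : nat) (d : R) : 0 < b -> 0 < d -> exists F : {fset T},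
  [/\ (F0 `<=` F)%fset, x0 \in F, (forall x, (n x <= e)%N -> x \in F) &
   [/\ `|\sum_(x <- F) gibbs H b x - 1| <= d,
       `|\sum_(x <- F) gibbs H b x * ((n x)%:R - nmean b)| <= d,
       `|\sum_(x <- F) gibbs H b x * ((n x)%:R - nmean b) ^+ 2 -
         var_energy H b / h ^+ 2| <= d,
       \sum_(x <- F) gibbs H b x <= 1 &
       \sum_(x <- F) gibbs H b x * `|(n x)%:R - nmean b| ^+ 3 <=
         4 * ((h ^+ 3)^-1 * (moment H 3 b / partition_fun H b) + nmean b ^+ 3)]].
Proof.
move=> b0 d0; have Z0 := partition_fun_gt0 Zs x0 b0.
have mu0 := mean_energy_gt0 H0 Zs x0 Hx1 b0.
have m0 : 0 <= nmean b by rewrite divr_ge0// ltW.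
have [G GP] := finite_sublevel Zs (h * e%:R).
(* [D = 1 + 2 * nmean b + nmean b ^+ 2] is the sum of the moduli of the coefficients in the centred
   second moment, so accuracy [d / D] on the raw moments is enough. *)
pose D := (1 + nmean b) ^+ 2.
have D0 : 0 < D by rewrite exprn_gt0// ltr_wpDr.
have D1 : 1 <= D by rewrite /D; nra.
have [s0 e0] := deg_moment 0 b0; have [s1 e1] := deg_moment 1 b0.
have [s2 e2] := deg_moment 2 b0; have [s3 e3] := deg_moment 3 b0.
have [F [GF h1 h2 h3]] :=
  rsum_approx3 (F0 `|` (x0 |` G))%fset s0 s1 s2 (divr_gt0 d0 D0).
have r0 : rsum (fun x => (n x)%:R ^+ 0 * gibbs H b x) = 1.
  by rewrite e0 expr0 invr1 mul1r -partition_funE divff// gt_eqF.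
have r1 : rsum (fun x => (n x)%:R ^+ 1 * gibbs H b x) = nmean b.
  by rewrite e1 /nmean (mean_energyE H0 Zs x0)// expr1 mulrC.
have r2 : rsum (fun x => (n x)%:R ^+ 2 * gibbs H b x) =
    var_energy H b / h ^+ 2 + nmean b ^+ 2.
  rewrite e2 (var_energyE H0 Zs x0)// /nmean; field.
  by rewrite !gt_eqF.
rewrite r0 in h1; rewrite r1 in h2; rewrite r2 in h3.
pose S j := \sum_(x <- F) (n x)%:R ^+ j * gibbs H b x.
have S0 : \sum_(x <- F) gibbs H b x = S 0%N.
  by apply: eq_bigr => x _; rewrite mul1r.
have S1 : \sum_(x <- F) gibbs H b x * ((n x)%:R - nmean b) = S 1%N - nmean b * S 0%N.
  by rewrite mulr_sumr -sumrB; apply: eq_bigr => x _; ring.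
have S2 : \sum_(x <- F) gibbs H b x * ((n x)%:R - nmean b) ^+ 2 =
    S 2%N - 2 * nmean b * S 1%N + nmean b ^+ 2 * S 0%N.
  by rewrite !mulr_sumr -sumrB -big_split/=; apply: eq_bigr => x _; ring.
have hd : d / D * D = d by rewrite divfK// gt_eqF.
have dD : 0 <= d / D by rewrite divr_ge0 ?ltW.
rewrite -/(S 0%N) in h1; rewrite -/(S 1%N) in h2; rewrite -/(S 2%N) in h3.
move: (d / D) hd dD h1 h2 h3 => q hd dD h1 h2 h3.
have S01 : S 0%N <= 1 by rewrite -r0; exact: fset_sum_le_rsum.
have S33 : S 3%N <= (h ^+ 3)^-1 * (moment H 3 b / partition_fun H b).
  by rewrite -e3; exact: fset_sum_le_rsum.
exists F; split.
- by apply: fsubset_trans GF; exact: fsubsetUl.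
- by apply: (fsubsetP GF); rewrite !inE eqxx orbT.
- move=> x xe; apply: (fsubsetP GF); rewrite !inE GP ?orbT//.
  by rewrite Hn ler_pM2l// ler_nat.
split; rewrite ?S0 ?S1 ?S2//.
- by rewrite (le_trans h1)// -hd ler_peMr.
- have -> : S 1%N - nmean b * S 0%N = (S 1%N - nmean b) - nmean b * (S 0%N - 1).
    by ring.
  rewrite (le_trans (ler_normB _ _))// normrM (ger0_norm m0) -hd.
  have := ler_wpM2l m0 h1; have := mulr_ge0 dD m0.
  by have := mulr_ge0 dD (exprn_ge0 2 m0); rewrite /D; lra.
- rewrite (_ : _ - _ = (S 2%N - (var_energy H b / h ^+ 2 + nmean b ^+ 2)) -
      2 * nmean b * (S 1%N - nmean b) + nmean b ^+ 2 * (S 0%N - 1)); last by ring.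
  rewrite (le_trans (ler_normD _ _))// (le_trans (lerD (ler_normB _ _) (lexx _)))//.
  rewrite (normrM (2 * nmean b)) (normrM (nmean b ^+ 2)) (ger0_norm (exprn_ge0 2 m0)).
  rewrite (ger0_norm (mulr_ge0 (ler0n R 2) m0)) -hd.
  have := ler_wpM2l (exprn_ge0 2 m0) h1.
  have := ler_wpM2l (mulr_ge0 (ler0n R 2) m0) h2.
  by rewrite /D (expr2 (1 + _)); lra.
(* The factor 4 comes from [(a + c) ^+ 3 <= 4 * (a ^+ 3 + c ^+ 3)] for nonnegative [a] and [c]. *)
- apply: (@le_trans _ _ (4 * (S 3%N + nmean b ^+ 3 * S 0%N))); last first.
    rewrite ler_pM2l// lerD// ler_piMr// exprn_ge0//.
  rewrite mulr_sumr -big_split mulr_sumr /=; apply: ler_sum => x _.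
  rewrite [leRHS](_ : _ = gibbs H b x * (4 * ((n x)%:R ^+ 3 + nmean b ^+ 3))); last by ring.
  rewrite ler_wpM2l ?gibbs_ge0//.
  have : `|(n x)%:R - nmean b| <= (n x)%:R + nmean b.
    by rewrite (le_trans (ler_normB _ _))// normr_nat ger0_norm.
  move=> le1; rewrite (le_trans (lerXn2r 3 _ _ le1)) ?nnegrE ?addr_ge0//.
  move: (ler0n R (n x)); move: (n x)%:R (nmean b) m0 => a c c0 a0.
  rewrite -subr_ge0.
  have -> : 4 * (a ^+ 3 + c ^+ 3) - (a + c) ^+ 3 = 3 * (a + c) * (a - c) ^+ 2.
    by ring.
  by rewrite mulr_ge0 ?sqr_ge0// mulr_ge0// addr_ge0.
Qed.

(** The atom at [x0], of degree 0, feeds [sqr_norm_charfun_le]; [aperiodic] and [one_sub_cos_ge]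
    then bound the deficit below by a multiple of [t ^+ 2]. The constant depends on [d] and [C] but
    not on the window [F], so it is uniform along a sequence of windows. *)
Let charfun_window b (F : {fset T}) (d : R) : 0 < b -> 0 <= d ->
  (F0 `<=` F)%fset -> forall x0F : x0 \in F,
  \sum_(x <- F) gibbs H b x <= 1 ->
  d <= gibbs H b x0 -> (forall x, x \in F0 -> d <= gibbs H b x) ->
  forall t, `|t| <= pi ->
  `|charfun (fun i : F => gibbs H b (val i)) (fun i => (n (val i))%:R) t| ^+ 2 <=
    (1 - 2 * (d ^+ 2 / (16 * C)) * t ^+ 2)%:C%C.
Proof.
move=> b0 d0 F0F x0F p1 dx0 dF0 t tpi.
have nx0 : (n (val [` x0F]%fset))%:R = 0 :> R by rewrite nH/= Hx0 mul0r.
apply: (le_trans (sqr_norm_charfun_le (i0 := [` x0F]%fset) _ _ nx0)).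
  by move=> i; exact: gibbs_ge0.
rewrite lecR (sum_fset_val F (gibbs H b)).
rewrite (sum_fset_val F (fun x => gibbs H b x * (1 - cos (t * (n x)%:R)))).
have W0 : 0 <= \sum_(x <- F) gibbs H b x.
  by apply: sumr_ge0 => x _; exact: gibbs_ge0.
have W1 : (\sum_(x <- F) gibbs H b x) ^+ 2 <= 1 by rewrite expr_le1.
rewrite lerB// -(mulrA 2) -(mulrA 2) ler_pM2l//.
have cos0 x : 0 <= 1 - cos (t * (n x)%:R) by rewrite subr_ge0 cos_le1.
have Q : d * \sum_(x <- F0) (1 - cos (t * (n x)%:R)) <=
    \sum_(x <- F) gibbs H b x * (1 - cos (t * (n x)%:R)).
  have := fset_sum_mono (f := fun x => gibbs H b x * (1 - cos (t * (n x)%:R)))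
    (fun x => mulr_ge0 (gibbs_ge0 x b0) (cos0 x)) F0F.
  apply: le_trans; rewrite mulr_sumr; apply: ler_sum_fset => x xF.
  by rewrite ler_wpM2r// dF0.
apply: (@le_trans _ _ (d * (d * \sum_(x <- F0) (1 - cos (t * (n x)%:R))))).
  have tS : t ^+ 2 / (16 * C) <= \sum_(x <- F0) (1 - cos (t * (n x)%:R)).
    have le := le_trans (one_sub_cos_ge tpi) (aperiodic t).
    by rewrite invfM mulrA ler_pdivrMr// [leRHS]mulrC.
  rewrite (_ : d ^+ 2 / (16 * C) * t ^+ 2 = d * (d * (t ^+ 2 / (16 * C)))); last by ring.
  by rewrite !ler_wpM2l.
apply: ler_pM => //; first by rewrite mulr_ge0// sumr_ge0.
Qed.

(** The targets [e N] may stay at bounded distance from the mean, so that one choice of parameters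
    serves both for a full shell and for a shell with finitely many particles removed. *)
Lemma shell_local_limit (b : R) (b_ : nat -> R) (e : nat -> nat) (K : R) : 0 < b ->
  (forall N, 0 < b_ N) -> b_ @ \oo --> b ->
  (\forall N \near \oo, `|N%:R * nmean (b_ N) - (e N)%:R| <= K) ->
  (fun N => Num.sqrt N%:R * ((shell_card H N (h * (e N)%:R))%:R *
     expR (- b_ N * (h * (e N)%:R)) / partition_fun H (b_ N) ^+ N)) @ \oo -->
  (Num.sqrt (2 * pi * (var_energy H b / h ^+ 2)))^-1.
Proof.
move=> b0 b_0 bb shift.
have Z0 := partition_fun_gt0 Zs x0 b0.
have v0 := var_energy_gt0 H0 Zs Hx0 Hx1 b0.
(* With this accuracy the truncation errors tend to 0 even after multiplication by [N]; [N.+1]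
   avoids a division by 0. *)
pose q N : R := N.+1%:R^-1 ^+ 2.
have q0 N : 0 < q N by rewrite exprn_gt0// invr_gt0.
have Nq N (a : R) : a <= q N -> N%:R * a <= N.+1%:R^-1.
  move=> aq; rewrite (le_trans (ler_wpM2l (ler0n _ N) aq))// /q expr2 mulrA.
  by rewrite ler_piMl ?invr_ge0// ler_pdivrMr// mul1r ler_nat.
have qcvg : q @ \oo --> 0.
  rewrite -(mulr0 0); under eq_cvg do rewrite /q expr2.
  by apply: cvgM; exact: cvg_harmonic.
have [F FP] := choice (fun N => @window (b_ N) (e N) (q N) (b_0 N) (q0 N)).
have Zcvg : (fun N => partition_fun H (b_ N)) @ \oo --> partition_fun H b.
  by apply: continuous_cvg => //; exact: partition_fun_continuous.
have mcvg : (fun N => nmean (b_ N)) @ \oo --> nmean b.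
  apply: cvgMr_tmp; apply: continuous_cvg => //; exact: mean_energy_continuous.
pose L c := 4 * ((h ^+ 3)^-1 * (moment H 3 c / partition_fun H c) + nmean c ^+ 3).
have Lcvg : (fun N => L (b_ N)) @ \oo --> L b.
  apply: cvgMl_tmp; apply: cvgD.
    apply: cvgMl_tmp; apply: cvgM.
      by apply: continuous_cvg => //; exact: moment_continuous.
    by apply: cvgV => //; rewrite gt_eqF.
  have cube (r : R) : r ^+ 3 = r * (r * r) by rewrite -expr2 -exprS.
  by rewrite cube; under eq_cvg do rewrite cube; do 2 apply: cvgM => //.
(* [M] bounds the energy at [x0] and on [F0]. Once [b_ N] lies between [b / 2] and [2 * b], [d]
   bounds the Gibbs masses there from below, uniformly in [N]. *)
pose M := \sum_(x <- F0) H x.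
pose d := expR (- (2 * b) * M) / partition_fun H (b / 2).
have b2 : 0 < b / 2 by rewrite divr_gt0.
have d0 : 0 < d by rewrite divr_gt0 ?expR_gt0// (partition_fun_gt0 Zs x0).
have gibbs_ge : \forall N \near \oo, forall x, H x <= M -> d <= gibbs H (b_ N) x.
  near=> N => x HM.
  have lo : b / 2 <= b_ N.
    by near: N; apply: (cvgr_ge b) => //; rewrite ltr_pdivrMr// ltr_pMr// ltr1n.
  have hi : b_ N <= 2 * b.
    by near: N; apply: (cvgr_le b) => //; rewrite ltr_pMl// ltr1n.
  rewrite /gibbs mulrC ler_pM ?expR_ge0 ?invr_ge0 ?(ltW (partition_fun_gt0 Zs x0 _))//.
    by rewrite ler_expR !mulNr lerN2 ler_pM// ltW.
  rewrite lef_pV2 ?posrE ?(partition_fun_gt0 Zs x0)// !partition_funE.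
  exact: moment_anti.
have cc0 : 0 < d ^+ 2 / (16 * C) by rewrite divr_gt0 ?exprn_gt0// mulr_gt0.
have vh0 : 0 < var_energy H b / h ^+ 2 by rewrite divr_gt0// exprn_gt0.
(* A single constant must bound both the shift and the third moments, hence the maximum. *)
have := @local_limit R (fun N => F N) (fun N i => gibbs H (b_ N) (val i))
  (fun N i => n (val i)) (fun N => nmean (b_ N)) e (var_energy H b / h ^+ 2)
  (d ^+ 2 / (16 * C)) (Num.max K (L b + 1)) cc0 vh0.
move=> lim; apply: cvg_trans; last apply: lim.
- apply: near_eq_cvg; apply: nearW => N /=; rewrite (@sum_prod_gibbs R T H h n)//.
  by have [] := FP N.
- by move=> N i; exact: gibbs_ge0.
- move=> N; rewrite (sum_fset_val (F N) (gibbs H (b_ N))).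
  by have [_ _ _ []] := FP N.
- apply: (@cvg_dist_le _ _ (@harmonic R)); last exact: cvg_harmonic.
  apply: nearW => N.
  rewrite subr0 (sum_fset_val (F N) (gibbs H (b_ N))) ger0_norm ?mulr_ge0//.
  by apply: Nq; have [_ _ _ []] := FP N.
- apply: (@cvg_dist_le _ _ (@harmonic R)); last exact: cvg_harmonic.
  apply: nearW => N.
  rewrite subr0 ger0_norm ?mulr_ge0// (sum_fset_val (F N)
    (fun x => gibbs H (b_ N) x * ((n x)%:R - nmean (b_ N)))).
  by apply: Nq; have [_ _ _ []] := FP N.
- apply: (@cvg_dist_le _ _ (fun N => q N +
    `|var_energy H (b_ N) / h ^+ 2 - var_energy H b / h ^+ 2|)).
    apply: nearW => N; rewrite (sum_fset_val (F N)
      (fun x => gibbs H (b_ N) x * ((n x)%:R - nmean (b_ N)) ^+ 2)).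
    have [_ _ _ [_ _ h3 _ _]] := FP N.
    by rewrite (le_trans (ler_distD (var_energy H (b_ N) / h ^+ 2) _ _))// lerD.
  rewrite -(addr0 0); apply: cvgD => //.
  have /cvg_norm : (fun N => var_energy H (b_ N) / h ^+ 2 - var_energy H b / h ^+ 2)
      @ \oo --> var_energy H b / h ^+ 2 - var_energy H b / h ^+ 2.
    apply: cvgB; last exact: cvg_cst.
    by apply: cvgMr_tmp; apply: continuous_cvg => //; exact: var_energy_continuous.
  by rewrite subrr normr0.
- near=> N; rewrite (sum_fset_val (F N)
      (fun x => gibbs H (b_ N) x * `|(n x)%:R - nmean (b_ N)| ^+ 3)).
  have [_ _ _ [_ _ _ _ h5]] := FP N; rewrite (le_trans h5)// le_max -/(L _).
  apply/orP; right; near: N; apply: (cvgr_le (L b)) => //.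
  by rewrite ltrDl.
- near=> N; have [F0F x0F _ [_ _ _ p1 _]] := FP N.
  have ge : forall x, H x <= M -> d <= gibbs H (b_ N) x by near: N.
  apply: charfun_window => //; first exact: ltW.
    by apply: ge; rewrite Hx0 sumr_ge0.
  move=> x xF0; apply: ge; rewrite /M (big_fsetD1 x)//= lerDl sumr_ge0//.
- by apply: filterS shift => N KN; rewrite le_max KN.
Unshelve. all: by end_near. Qed.

End shell_local_limit.

(* The integers [k] for which [1 - cos (t * k)] is dominated by finitely many of
   the [1 - cos (t * n x)], uniformly in [t], form a subgroup. *)
Lemma span_aperiodic (R : realType) (T : choiceType) (H : T -> R) (h : R)
    (n : T -> nat) : 0 < h -> (forall x, H x = h * (n x)%:R) ->
  maximal_span (range H) h ->
  exists (F : {fset T}) (C : R), 0 < C /\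
    forall t, 1 - cos t <= C * \sum_(x <- F) (1 - cos (t * (n x)%:R)).
Proof.
move=> h0 Hn [_ _ gen].
pose Q (F : {fset T}) (t : R) := \sum_(x <- F) (1 - cos (t * (n x)%:R)).
have Q0 F t : 0 <= Q F t by apply: sumr_ge0 => x _; rewrite subr_ge0 cos_le1.
have Qmono F G t : (F `<=` G)%fset -> Q F t <= Q G t.
  by apply: fset_sum_mono => x; rewrite subr_ge0 cos_le1.
pose G : set int := [set k | exists (F : {fset T}) (C : R), 0 < C /\
  forall t, 1 - cos (t * k%:~R) <= C * Q F t].
have [subG genG] : is_subgroup G /\
    [set z : int | exists2 a, range H a & a / h = z%:~R] `<=` G.
  split; first split.
  - exists fset0, 1; split => // t; rewrite mulr0 cos0 subrr mulr_ge0//.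
  - move=> k l [F [C [C0 FC]]] [F' [C' [C'0 FC']]].
    exists (F `|` F')%fset, (2 * C + 2 * C'); split; first by rewrite addr_gt0// mulr_gt0.
    move=> t; rewrite rmorphB/= mulrBr (le_trans (one_sub_cosB _ _))//.
    rewrite [leRHS]mulrDl -(mulrA 2 C) -(mulrA 2 C') lerD// ler_pM2l//.
      by rewrite (le_trans (FC t))// ler_pM2l// Qmono// fsubsetUl.
    by rewrite (le_trans (FC' t))// ler_pM2l// Qmono// fsubsetUr.
  - move=> z [_ [x _ <-]]; rewrite Hn mulrAC divff ?gt_eqF// mul1r => nz.
    exists [fset x]%fset, 1; split => // t.
    by rewrite mul1r /Q big_seq_fset1 -nz.
have : smallest is_subgroup
    [set z : int | exists2 a, range H a & a / h = z%:~R] 1 by rewrite gen.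
move=> /(_ G (conj subG genG))[F [C [C0 FC]]]; exists F, C; split => // t.
by have := FC t; rewrite mulr1.
Qed.

(** * Geometric sums and sums over coordinate boxes *)

Section geometric_sums.
Variable R : realType.

Lemma nat_geometric_le (q : R) (s : seq nat) : uniq s -> 0 <= q -> q < 1 ->
  \sum_(i <- s) q ^+ i <= (1 - q)^-1.
Proof.
move=> us q0 q1.
pose M := (\sum_(i <- s) i).+1.
have sM : perm_eq s [seq i <- index_iota 0 M | i \in s].
  apply: uniq_perm; rewrite ?filter_uniq ?iota_uniq// => i.
  rewrite mem_filter mem_index_iota/=; have [iF|//] := boolP (i \in s).
  by rewrite /M ltnS (big_rem i)//= leq_addr.
rewrite (perm_big _ sM) big_filter big_mkcond.
apply: (@le_trans _ _ (\sum_(0 <= i < M) q ^+ i)).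
  by apply: ler_sum => i _; case: ifP => // _; rewrite exprn_ge0.
rewrite big_mkord.
rewrite -div1r ler_pdivlMr ?subr_gt0// mulrC.
have := subrX1 q M; have := exprn_ge0 M q0; lra.
Qed.

(** [absz] is injective on each of the two half-lines, whence the factor 2. *)
Lemma int_geometric_le (q : R) (F : {fset int}) : 0 <= q -> q < 1 ->
  \sum_(z <- F) q ^+ `|z|%N <= 2 * (1 - q)^-1.
Proof.
move=> q0 q1; rewrite (big_fsetID _ (fun z : int => 0 <= z))/= mulr2n mulrDl !mul1r.
have half (A : {fset int}) : {in A &, injective absz} ->
    \sum_(z <- A) q ^+ `|z|%N <= (1 - q)^-1.
  move=> inj; rewrite -(big_map absz xpredT (fun i => q ^+ i)).
  by apply: nat_geometric_le => //; rewrite map_inj_in_uniq ?fset_uniq.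
apply: lerD; apply: half => x y; rewrite !inE/=.
  move=> /andP[_ x0] /andP[_ y0] xy.
  by rewrite -(gez0_abs x0) -(gez0_abs y0) xy.
rewrite -!ltNge => /andP[_ x0] /andP[_ y0] xy.
by rewrite -[x]opprK -[y]opprK -(ltz0_abs x0) -(ltz0_abs y0) xy.
Qed.

End geometric_sums.

(** Injective coordinates embed [F] into a finite box, over which the sum of products factorises. It
    serves both for the lattice and for product masses. *)
Lemma box_sum_le (R : realType) (T A : choiceType) (d : nat) (c : T -> 'I_d -> A)
    (w : A -> R) (B : R) (F : {fset T}) : (forall a, 0 <= w a) ->
  (forall S : {fset A}, \sum_(a <- S) w a <= B) ->
  (forall x y, c x =1 c y -> x = y) -> \sum_(x <- F) \prod_k w (c x k) <= B ^+ d.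
Proof.
move=> w0 wB inj.
pose S := [fset a in [seq c x k | x <- enum_fset F, k <- enum 'I_d]]%fset.
have cS (x : F) k : c (val x) k \in S.
  by rewrite inE/=; apply: allpairs_f; [exact: valP|rewrite mem_enum].
pose phi (x : F) : {ffun 'I_d -> S} := [ffun k => [` cS x k]%fset].
pose G (f : {ffun 'I_d -> S}) := \prod_k w (val (f k)).
have G0 f : 0 <= G f by exact: prodr_ge0.
have phi_inj : {in [set: F]%SET &, injective phi}.
  move=> x y _ _ xy; apply/val_inj/inj => k.
  by have := congr1 (fun f : {ffun 'I_d -> S} => val (f k)) xy; rewrite !ffunE.
rewrite -(sum_fset_val F (fun x => \prod_k w (c x k))).
have -> : \sum_(x : F) \prod_k w (c (val x) k) = \sum_(x in [set: F]%SET) G (phi x).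
  apply: eq_big => [x|x _]; first by rewrite inE.
  by apply: eq_bigr => k _; rewrite ffunE.
rewrite -(big_imset G phi_inj)/=.
apply: (@le_trans _ _ (\sum_f G f)).
  by rewrite big_mkcond/=; apply: ler_sum => f _; case: ifP.
rewrite -(bigA_distr_bigA (fun (_ : 'I_d) (z : S) => w (val z))).
rewrite prodr_const card_ord (sum_fset_val S w).
rewrite lerXn2r ?nnegrE//; first by exact: sumr_ge0.
by rewrite (le_trans _ (wB fset0))// big_seq_fset0.
Qed.

(** * Geometry of the lattice *)

Section inner_products.
Variables (R : realType) (V : lmodType R) (ip : {dot V for idfun}).

Lemma dot_sym u v : ip u v = ip v u.
Proof. by have := @hermC _ _ _ _ ip u v; rewrite /= mul1r. Qed.

Lemma dot_ge0 v : 0 <= ip v v.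
Proof.
have [->|v0] := eqVneq v 0; first by rewrite linear0l.
by rewrite ltW// neq0_dnorm_gt0.
Qed.

Lemma dot_cauchy_schwarz u v : ip u v ^+ 2 <= ip u u * ip v v.
Proof.
have [->|v0] := eqVneq v 0; first by rewrite linear0r expr0n/= linear0l mulr0.
have vv : 0 < ip v v by rewrite neq0_dnorm_gt0.
(* Expanding this square norm gives [ip v v] times the wanted difference. *)
have := dot_ge0 (ip v v *: u - ip u v *: v).
rewrite linearBl !linearB /= !linearZl_LR !linearZ/= /GRing.scale/=.
rewrite (dot_sym v u) => h.
rewrite -subr_ge0 -(pmulr_rge0 _ vv); move: h.
by congr (0 <= _); ring.
Qed.

End inner_products.

Section lattice_geometry.
Import VectorInternalTheory.
Variables (R : realType) (L : vectType int) (V : lmodType R).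
Variables (iota : {additive L -> V}) (nrm : V -> R).
Hypotheses (V_ext : extension_of_scalars iota) (nrm_eucl : euclidean_norm nrm).

Let d := dim L.
(** A [vectType int] carries an isomorphism [v2r] with integer row vectors, that is, a basis of the
    lattice. *)
Let coords (x : L) : 'rV[int]_d := v2r x.
Let base (k : 'I_d) : L := @r2v _ L (delta_mx 0 k).

Let iota_coords x : iota x = \sum_k (coords x 0 k)%:~R *: iota (base k).
Proof.
rewrite -[in LHS](v2rK x) (matrix_sum_delta (v2r x)) big_ord1 !raddf_sum.
apply: eq_bigr => k _; transitivity (iota (coords x 0 k *: base k)).
  by congr (iota _); exact: (linearZ_LR (@r2v _ L)).
by rewrite scaler_int -raddfMz -scaler_int intz.
Qed.

Lemma energy_ge0 x : 0 <= energy iota nrm x.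
Proof. exact: sqr_ge0. Qed.

Lemma energy0 : energy iota nrm 0 = 0.
Proof.
have [ip ipE] := nrm_eucl.
by rewrite /energy raddf0 ipE linear0l sqrtr0 expr0n.
Qed.

(* [u k] is the basis dual to [iota (base k)] for the inner product, so the
   coordinates of [x] are the inner products of [iota x] with the [u k]. *)
Lemma coord_sum_le_energy : exists B : R, 0 < B /\
  forall x, (\sum_k `|coords x 0%R k|%N)%:R <= B * energy iota nrm x.
Proof.
have [ip ipE] := nrm_eucl.
have HE x : energy iota nrm x = ip (iota x) (iota x).
  by rewrite /energy ipE sqr_sqrtr// dot_ge0.
pose f : {additive L -> 'rV[R]_d} := (map_mx intr \o coords : L -> 'rV[R]_d).
(* The universal property extends the integer coordinates to a real linear map [g], which makes the
   vectors [w k] linearly independent. *)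
have [g [gf _]] := V_ext f.
pose w k := iota (base k).
have gw k : g (w k) = delta_mx 0 k.
  by rewrite gf /= /coords r2vK map_delta_mx.
pose G : 'M[R]_d := \matrix_(i, j) ip (w i) (w j).
(* A row in the kernel of the Gram matrix defines a vector [v] orthogonal to all [w j], hence to
   itself; so [v = 0], and [g v] recovers the row. *)
have Gunit : G \in unitmx.
  rewrite -row_free_unit; apply: inj_row_free => c cG.
  pose v := \sum_i c 0 i *: w i.
  have ipv z : ip v z = \sum_i c 0 i * ip (w i) z.
    by rewrite /v linear_sumlz; apply: eq_bigr => i _; rewrite linearZl_LR.
  have vw j : ip v (w j) = 0.
    rewrite ipv; transitivity ((c *m G) 0 j); last by rewrite cG mxE.
    by rewrite mxE; apply: eq_bigr => i _; rewrite mxE.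
  have vv : ip v v = 0.
    by rewrite ipv big1// => i _; rewrite dot_sym vw mulr0.
  have v0 : v = 0.
    apply/eqP; apply: contraTT isT => v0.
    have : 0 < ip v v by rewrite neq0_dnorm_gt0.
    by rewrite vv ltxx.
  have := congr1 g v0; rewrite raddf0 /v raddf_sum => <-.
  rewrite [LHS]row_sum_delta; apply: eq_bigr => i _.
  by rewrite -gw; exact: (esym (linearZ_LR g _ _)).
pose u k := \sum_j (invmx G) k j *: w j.
have uw k j : ip (u k) (w j) = (k == j)%:R.
  rewrite /u linear_sumlz.
  transitivity ((invmx G *m G) k j); last by rewrite mulVmx// mxE.
  by rewrite mxE; apply: eq_bigr => i _; rewrite linearZl_LR/= [in RHS]mxE.
have coordE x k : ip (u k) (iota x) = (coords x 0 k)%:~R.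
  rewrite iota_coords linear_sumr (bigD1 k)//= big1 ?addr0 => [|j jk].
    by rewrite linearZr_LR/= -/(w k) uw eqxx mulr1.
  by rewrite linearZr_LR/= -/(w j) uw eq_sym (negbTE jk) mulr0.
exists (\sum_k ip (u k) (u k) + 1); split.
  by rewrite ltr_wpDl// sumr_ge0// => k _; exact: dot_ge0.
move=> x; rewrite mulrDl ler_wpDr ?mul1r ?energy_ge0//.
rewrite natr_sum mulr_suml; apply: ler_sum => k _.
rewrite HE (le_trans _ (dot_cauchy_schwarz _ _ _))// coordE.
rewrite -(real_normK (num_real _)) -intr_norm -natr_absz -natrX ler_nat.
(* A natural number is at most its square: the quadratic bound becomes a linear one, which suits
   geometric sums. *)
by case: `|_|%N => // m; rewrite leq_pmulr.
Qed.

(** Each weight is at most a product over the coordinates of powers of [q], so finite sums are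
    bounded by a power of a geometric series. *)
Lemma nnsummable_lattice b : (0 < d)%N -> 0 < b ->
  nnsummable (fun x => expR (- b * energy iota nrm x)).
Proof.
move=> d0 b0; have [B [B0 HB]] := coord_sum_le_energy.
pose q := expR (- (b / B)).
have q0 : 0 <= q by exact: expR_ge0.
have q1 : q < 1 by rewrite expR_lt1 oppr_lt0 divr_gt0.
apply: (nnsummable_bounded (B := (2 * (1 - q)^-1) ^+ d) _ _).1 => [x|F].
  exact: expR_ge0.
have inj x y : coords x 0 =1 coords y 0 -> x = y.
  by move=> xy; apply: v2r_inj; apply/rowP.
have w0 (z : int) : 0 <= q ^+ `|z|%N by rewrite exprn_ge0.
apply: le_trans (box_sum_le F w0 (fun S => int_geometric_le S q0 q1) inj).
apply: ler_sum_fset => x _.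
rewrite prodrXr -expRM_natl ler_expR mulrN mulNr lerN2 mulrC.
by rewrite -mulrA ler_pM2l// mulrC ler_pdivrMr// mulrC.
Qed.

Lemma lattice_infinite k : (0 < d)%N -> exists F : {fset L}, (k <= #|` F|)%N.
Proof.
move=> d0; pose f (i : nat) : L := base (Ordinal d0) *+ i.
have coordE i : coords (f i) 0 (Ordinal d0) = i%:R.
  have bE : coords (base (Ordinal d0)) = delta_mx 0 (Ordinal d0) by exact: r2vK.
  transitivity ((coords (base (Ordinal d0)) *+ i) 0 (Ordinal d0)).
    by congr (fun_of_matrix _ _ _); exact: (raddfMn (@v2r _ L) i (base (Ordinal d0))).
  by rewrite bE mulmxnE mxE !eqxx.
have f_inj : injective f.
  move=> i j /(congr1 (fun x => coords x 0 (Ordinal d0))).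
  by rewrite !coordE => /eqP; rewrite eqr_nat => /eqP.
exists [fset f i | i in seq.iota 0 k]%fset.
by rewrite card_imfset//= undup_id ?iota_uniq// size_iota.
Qed.

End lattice_geometry.

(** * Total variation *)

Section scheffe.
Variables (R : realType) (U : choiceType).

Lemma fset_sum_split (F F' : {fset U}) : exists G : {fset U},
  forall f : U -> R, \sum_(y <- (F `|` F')%fset) f y =
    \sum_(y <- F) f y + \sum_(y <- G) f y.
Proof.
exists [fset y in (F `|` F')%fset | y \notin F]%fset => g.
rewrite (big_fsetID _ (fun y => y \in F))/=; congr (_ + _).
apply: eq_fbigl => x; rewrite !inE/=; case: (x \in F) => //=.
by rewrite andbF.
Qed.

(* Scheffe: pointwise convergence of probability masses to a probability mass
   controls the mass outside a finite set, hence gives convergence in total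
   variation. *)
Lemma tv_dist_cvg0 (q_ : nat -> U -> R) (q : U -> R) :
  (forall N y, 0 <= q_ N y) -> (forall y, 0 <= q y) ->
  (forall N (F : {fset U}), \sum_(y <- F) q_ N y <= 1) ->
  (forall F : {fset U}, \sum_(y <- F) q y <= 1) ->
  (forall e, 0 < e -> exists F : {fset U}, 1 - e <= \sum_(y <- F) q y) ->
  (forall y, q_ ^~ y @ \oo --> q y) ->
  (fun N => tv_dist (q_ N) q) @ \oo --> (0 : R).
Proof.
move=> q_0 q0 q_1 q1 tight qq; apply/cvgr0Pnorm_le => e e0.
have e2 : 0 < e / 2 by rewrite divr_gt0.
have [F Fe] := tight _ e2.
have dF0 : (fun N => \sum_(y <- F) `|q_ N y - q y|) @ \oo --> (0 : R).
  have d0 y : (fun N => `|q_ N y - q y|) @ \oo --> (0 : R).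
    have /cvg_norm : (fun N => q_ N y - q y) @ \oo --> q y - q y.
      by apply: cvgB; [exact: qq|exact: cvg_cst].
    by rewrite subrr normr0.
  have := @cvg_sum_seq _ _ \oo R (enum_fset F) (fun y N => `|q_ N y - q y|)
    (fun _ => 0) (@eventually_filter) d0.
  by rewrite big1.
near=> N.
have dN : \sum_(y <- F) `|q_ N y - q y| <= e / 2.
  rewrite -[leLHS]ger0_norm ?sumr_ge0//; near: N.
  by move/cvgr0Pnorm_le : dF0; exact.
(* [e / 2] on [F], [e / 2] for the mass of [q] off [F], and [e] for that of [q_ N], which is
   compared with [q] on [F]. The total [2 * e] is halved by [tv_dist]. *)
have dF' (F' : {fset U}) : \sum_(y <- F') `|q_ N y - q y| <= 2 * e.
  have [G GE] := fset_sum_split F F'.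
  have := fset_sum_mono (f := fun y => `|q_ N y - q y|) (fun y => normr_ge0 _)
    (fsubsetUr F F').
  have := q_1 N (F `|` F')%fset; have := q1 (F `|` F')%fset; rewrite !GE.
  have : \sum_(y <- G) `|q_ N y - q y| <= \sum_(y <- G) (q_ N y + q y).
    apply: ler_sum_fset => y _; rewrite (le_trans (ler_normB _ _))//.
    by rewrite !ger0_norm.
  rewrite big_split/=.
  have : \sum_(y <- F) q y <=
      \sum_(y <- F) q_ N y + \sum_(y <- F) `|q_ N y - q y|.
    rewrite -big_split/=; apply: ler_sum_fset => y _.
    have := ler_norm (q y - q_ N y); rewrite distrC; lra.
  by lra.
have [ds dle] := nnsummable_bounded (fun y => normr_ge0 (q_ N y - q y)) dF'.
rewrite /tv_dist -/(rsum _) ger0_norm.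
  by rewrite ler_pdivrMl// mulrC; lra.
by rewrite mulr_ge0 ?invr_ge0//; exact: rsum_ge0.
Unshelve. all: by end_near. Qed.

End scheffe.

(** * Product masses *)

Section product_masses.
Variables (R : realType) (T : choiceType) (w : T -> R) (k : nat).
Hypotheses (w0 : forall x, 0 <= w x) (ws : nnsummable w) (w1 : rsum w = 1).

Lemma product_mass_ge0 (y : k.-tuple T) : 0 <= product_mass w y.
Proof. exact: prodr_ge0. Qed.

Lemma product_mass_sum_le1 (F : {fset k.-tuple T}) :
  \sum_(y <- F) product_mass w y <= 1.
Proof.
rewrite -(expr1n _ k).
apply: (@box_sum_le R _ T k (fun y i => tnth y i)) => //.
  by move=> S; rewrite -w1; exact: fset_sum_le_rsum.
by move=> x y xy; apply: eq_from_tnth.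
Qed.

(** A box over a finite set [S] of mass above [1 - q] has mass at least [(1 - q) ^+ k], to which
    Bernoulli's inequality applies. *)
Lemma product_mass_tight (e : R) : 0 < e ->
  exists F : {fset k.-tuple T}, 1 - e <= \sum_(y <- F) product_mass w y.
Proof.
(* The minimum with 1 keeps Bernoulli's inequality applicable; [k.+1] avoids a division by 0. *)
move=> e0; pose q := Num.min 1 (e / k.+1%:R).
have q0 : 0 < q by rewrite lt_min ltr01 divr_gt0.
have [S [_ Sq]] := rsum_approx fset0 ws q0.
pose tup (f : {ffun 'I_k -> S}) : k.-tuple T := [tuple val (f i) | i < k].
have tup_inj : injective tup.
  move=> f g fg; apply/ffunP => i; apply: val_inj.
  by have := congr1 (fun t => tnth t i) fg; rewrite !tnth_mktuple.
exists [fset tup f | f in {ffun 'I_k -> S}]%fset.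
rewrite big_imfset/=; last by move=> x y _ _; exact: tup_inj.
have -> : \sum_(f <- enum {: {ffun 'I_k -> S}}) product_mass w (tup f) =
    (\sum_(x <- S) w x) ^+ k.
  rewrite big_enum/= -(sum_fset_val S w) -[in RHS](card_ord k) -prodr_const.
  rewrite (bigA_distr_bigA (fun (_ : 'I_k) (z : S) => w (val z))).
  by apply: eq_bigr => f _; apply: eq_bigr => i _; rewrite tnth_mktuple.
have bernoulli (a : R) j : 0 <= a -> a <= 1 -> 1 - j%:R * a <= (1 - a) ^+ j.
  move=> a0 a1; elim: j => [|j IHj]; first by rewrite mul0r subr0.
  rewrite exprS -natr1 (le_trans _ (ler_wpM2l _ IHj)) ?subr_ge0//.
  have : 0 <= j%:R * (a * a) by rewrite mulr_ge0// mulr_ge0.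
  lra.
apply: (@le_trans _ _ ((1 - q) ^+ k)); last first.
  rewrite lerXn2r ?nnegrE ?subr_ge0 ?ge_min ?lexx//; last by rewrite -w1 ltW.
  exact: sumr_ge0.
apply: le_trans (bernoulli q k (ltW q0) _); last by rewrite ge_min lexx.
rewrite lerB// (@le_trans _ _ (k%:R * (e / k.+1%:R)))//.
  by rewrite ler_wpM2l// ge_min lexx orbT.
by rewrite mulrCA ler_piMr ?(ltW e0)// ler_pdivrMr// mul1r ler_nat.
Qed.

End product_masses.

(** * Marginals and shell measures *)

Section marginals.
Variables (R : realType) (T U : choiceType) (f : T -> U) (mu : T -> R).
Hypothesis mus : nnsummable mu.

Let fiber y x := if f x == y then mu x else 0.

Let fiber_summable y : nnsummable (fiber y).
Proof.
apply: (nnsummable_le mus _).1 => x; rewrite /fiber.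
by case: ifP; rewrite lexx (mus.1 x).
Qed.

Let pushforwardE y : pushforward_mass f mu y = rsum (fiber y).
Proof.
rewrite /pushforward_mass /rsum esum_mkcond; congr fine; apply: eq_esum => x _.
rewrite /fiber; case: ifPn => [|]; first by rewrite inE/= => /eqP ->.
by rewrite notin_setE/= => /eqP/negbTE ->.
Qed.

Lemma pushforward_mass_ge0 y : 0 <= pushforward_mass f mu y.
Proof. by rewrite pushforwardE rsum_ge0. Qed.

(** Fibres over distinct points are disjoint, so at each [x] at most one term of the sum of fibres
    is nonzero. *)
Lemma pushforward_mass_sum_le (F : {fset U}) :
  \sum_(y <- F) pushforward_mass f mu y <= rsum mu.
Proof.
have fib (s : seq U) : uniq s -> nnsummable (fun x => \sum_(y <- s) fiber y x) /\
    rsum (fun x => \sum_(y <- s) fiber y x) = \sum_(y <- s) rsum (fiber y).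
  elim: s => [_|y s IHs /= /andP[_ us]].
    rewrite big_nil (_ : (fun x => _) = (fun x => 0 * mu x)); last first.
      by apply/funext => x; rewrite big_nil mul0r.
    by have [h ->] := nnsummableZ (lexx 0) mus; rewrite mul0r.
  have [s1 e1] := IHs us; rewrite big_cons -e1.
  rewrite (_ : (fun x => _) = fiber y \+ (fun x => \sum_(y <- s) fiber y x)).
    exact: nnsummableD.
  by apply/funext => x; rewrite big_cons.
under eq_bigr do rewrite pushforwardE.
have [_ <-] := fib _ (fset_uniq F); apply: (nnsummable_le mus _).2 => x.
have [xF|xF] := boolP (f x \in F).
  rewrite (big_fsetD1 (f x))//= big_seq big1 ?addr0 => [|y].
    by rewrite /fiber eqxx lexx (mus.1 x).
  by rewrite !inE /fiber eq_sym => /andP[/negbTE ->].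
rewrite big_seq big1 ?lexx ?(mus.1 x)// => y yF; rewrite /fiber.
by case: eqP xF => // ->; rewrite yF.
Qed.

End marginals.

Lemma nnsummable_uniform (R : realType) (T : choiceType) (A : set T) : finite_set A ->
  nnsummable (uniform R A) /\ rsum (uniform R A) <= 1.
Proof.
move=> finA; apply: nnsummable_bounded => [x|F].
  by rewrite /uniform divr_ge0// indicE.
rewrite -mulr_suml; set g := #|` fset_set A|.
have : \sum_(x <- F) \1_A x <= g%:R :> R.
  rewrite (eq_bigr (fun x => (x \in A : nat)%:R)) => [|x _]; last by rewrite indicE.
  rewrite -natr_sum ler_nat -(big_mkcond (fun x => x \in A) (fun=> 1%N)).
  rewrite -big_filter sum1_size uniq_leq_size ?filter_uniq ?fset_uniq// => x.
  by rewrite mem_filter in_fset_set// => /andP[].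
(* For an empty [A] the mass is 0 by the convention on division, which is why only [<= 1] is
   claimed. *)
have [->|g0] := eqVneq g 0%N; first by rewrite invr0 mulr0.
by rewrite ler_pdivrMr ?mul1r// ltr0n lt0n.
Qed.

Section shell_marginals.
Variables (R : realType) (L : zmodType) (H : L -> R) (k N : nat).
Implicit Types (y : k.-tuple L) (z : N.-tuple L).

Lemma total_energy_cat y z :
  total_energy H [tuple of y ++ z] = total_energy H y + total_energy H z.
Proof. by rewrite /total_energy -!(big_tuple _ _ _ xpredT H) big_cat. Qed.

Lemma val_proj_first (x : (k + N).-tuple L) : val (proj_first k x) = take k x.
Proof.
have sk : size (take k x) = k by rewrite size_takel// size_tuple leq_addr.
apply: (@eq_from_nth _ 0); first by rewrite size_tuple sk.
rewrite size_tuple => i ik; rewrite nth_take//.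
have -> : nth 0 (val (proj_first k x)) i = tnth (proj_first k x) (Ordinal ik).
  by rewrite (tnth_nth 0).
by rewrite tnth_mktuple.
Qed.

(** Prepending [y] is a bijection from the shell of the remaining energy onto the part of the full
    shell above [y], where the shell measure is constant. *)
Lemma pushforward_shell (E : R) y :
  finite_set (shell H (E - total_energy H y) : set (N.-tuple L)) ->
  pushforward_mass (@proj_first L k (k + N)) (shell_measure H E) y =
  (shell_card H N (E - total_energy H y))%:R / (shell_card H (k + N) E)%:R.
Proof.
set S := shell H _ => finS; rewrite /pushforward_mass /shell_measure /uniform.
rewrite -/(shell_card H (k + N) E); set g := (shell_card H (k + N) E)%:R.
rewrite (@eq_esum _ _ _ _ (fun x =>
    if x \in (shell H E : set ((k + N).-tuple L)) then g^-1%:E else 0%E)); last first.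
  by move=> x _; rewrite indicE; case: ifP => _; rewrite ?mul1r ?mul0r.
rewrite -esum_mkcondr.
have -> : (@proj_first L k (k + N)) @^-1` [set y] `&` shell H E =
    [set [tuple of y ++ z] | z in S].
  apply/seteqP; split => x /=.
    move=> [xy xE].
    have sz : size (drop k x) == N by rewrite size_drop size_tuple addKn.
    have xE' : x = [tuple of y ++ Tuple sz].
      by apply: val_inj; rewrite /= -xy val_proj_first cat_take_drop.
    exists (Tuple sz) => //; rewrite /S /shell/=.
    by move: xE; rewrite /shell/= {1}xE' total_energy_cat => <-; rewrite addrC addKr.
  move=> [z zS <-]; split.
    by apply: val_inj; rewrite val_proj_first/= take_size_cat// size_tuple.
  by rewrite /shell/= total_energy_cat; move: zS; rewrite /S /shell/= => ->; rewrite addrC subrK.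
rewrite esum_image; last first.
  move=> z z' _ _ /(congr1 (fun t : (k + N).-tuple L => drop k t))/=.
  by rewrite !drop_size_cat ?size_tuple// => /val_inj.
rewrite esum_fset//; last by move=> z _; rewrite lee_fin invr_ge0 ler0n.
rewrite fsbig_finite//= sumEFin/= big_const_seq count_predT iter_addr_0.
by rewrite -[LHS]mulr_natl.
Qed.

End shell_marginals.

(** * The microcanonical ensemble *)

Section microcanonical.
Variables (R : realType) (L : zmodType) (H : L -> R) (h : R) (n : L -> nat).
Variables (x0 x1 : L) (F0 : {fset L}) (C : R).
Hypotheses (h0 : 0 < h) (Hn : forall x, H x = h * (n x)%:R).
Hypothesis Zs : forall b, 0 < b -> nnsummable (fun x => expR (- b * H x)).
Hypotheses (Hx0 : H x0 = 0) (Hx1 : 0 < H x1) (C0 : 0 < C).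
Hypothesis aperiodic :
  forall t, 1 - cos t <= C * \sum_(x <- F0) (1 - cos (t * (n x)%:R)).
Hypothesis infL : forall k, exists F : {fset L}, (k <= #|` F|)%N.
Variables (E : nat -> R) (e : nat -> nat) (u : R).
Hypotheses (Ee : forall N, (0 < N)%N -> E N = h * (e N)%:R) (u0 : 0 < u).
Hypothesis E_cvg : (fun N => E N / N%:R) @ \oo --> u.

Let H0 x : 0 <= H x. Proof. by rewrite Hn mulr_ge0// ltW. Qed.

Let gap x : H x = 0 \/ h <= H x.
Proof.
rewrite Hn; case: (n x) => [|m]; [by left; rewrite mulr0|right].
by rewrite ler_peMr ?(ltW h0)// ler1n.
Qed.

Let b := mean_energy_inv H u.
Let b_ N := mean_energy_inv H (E N / N%:R).
(* [b_ N] is a junk value when [E N / N%:R] is not positive; [pos_b_] agrees with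
   it eventually and is positive for every [N]. *)
Let pos_b_ N := if 0 < E N / N%:R then b_ N else b.

Let inv_ok v (v0 : 0 < v) := mean_energy_invP H0 Zs Hx0 Hx1 h0 gap infL v0.

Let b0 : 0 < b. Proof. exact: (inv_ok u0).1. Qed.
Let mb : mean_energy H b = u. Proof. exact: (inv_ok u0).2. Qed.

Let pos_b_gt0 N : 0 < pos_b_ N.
Proof. by rewrite /pos_b_; case: ifP => // /inv_ok[]. Qed.

Lemma mean_shell_energy_gt0 : \forall N \near \oo, 0 < E N / N%:R.
Proof. exact: (cvgr_gt u). Qed.

Let pos_bE : \forall N \near \oo,
  pos_b_ N = b_ N /\ mean_energy H (pos_b_ N) = E N / N%:R.
Proof.
apply: filterS mean_shell_energy_gt0 => N uN; rewrite /pos_b_ uN.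
by split => //; exact: (inv_ok uN).2.
Qed.

Let pos_b_cvg : pos_b_ @ \oo --> b.
Proof.
apply: cvg_trans (mean_energy_inv_cvg H0 Zs Hx0 Hx1 h0 gap infL u0 E_cvg).
by apply: near_eq_cvg; apply: filterS pos_bE => N [].
Qed.

Let Z0 : 0 < partition_fun H b. Proof. exact (partition_fun_gt0 Zs x0 b0). Qed.

Let c0 := (Num.sqrt (2 * pi * (var_energy H b / h ^+ 2)))^-1.

Let v0 : 0 < var_energy H b. Proof. exact: (var_energy_gt0 H0 Zs Hx0 Hx1 b0). Qed.

Let c0_gt0 : 0 < c0.
Proof. by rewrite invr_gt0 sqrtr_gt0 !mulr_gt0 ?pi_gt0// invr_gt0 exprn_gt0. Qed.

(** Scaled by the square root of [N], the probability that [N] independent Gibbs variables have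
    total energy [E N]. *)
Let density N := Num.sqrt N%:R * ((shell_card H N (E N))%:R *
  expR (- pos_b_ N * E N) / partition_fun H (pos_b_ N) ^+ N).

(** For large [N] the parameter makes the mean exactly [E N / N%:R], so the shift bound holds with
    [K := 0]. *)
Let density_cvg : density @ \oo --> c0.
Proof.
have lim := shell_local_limit h0 Hn Zs Hx0 Hx1 C0 aperiodic (e := e) (K := 0)
  b0 pos_b_gt0 pos_b_cvg.
apply: cvg_trans (lim _); last first.
  near=> N; have N0 : (0 < N)%N by near: N; exists 1%N.
  have -> : mean_energy H (pos_b_ N) = E N / N%:R.
    by near: N; apply: filterS pos_bE => N [].
  rewrite Ee// (_ : _ - _ = 0) ?normr0//.
  by field; rewrite gt_eqF//= pnatr_eq0 -lt0n.
apply: near_eq_cvg; near=> N; have N0 : (0 < N)%N by near: N; exists 1%N.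
by rewrite /density Ee.
Unshelve. all: by end_near. Qed.

Let Zcvg : (fun N => partition_fun H (pos_b_ N)) @ \oo --> partition_fun H b.
Proof. by apply: continuous_cvg => //; exact: partition_fun_continuous. Qed.

(** This is [density] solved for the cardinal of the shell; the relative error is
    [density N * r N - 1], where [r] tends to [c0^-1]. *)
Lemma shell_card_asymp : exists2 eps : nat -> R, eps @ \oo --> (0 : R) &
  \forall N \near \oo, (shell_card H N (E N))%:R =
    h * partition_fun H (b_ N) ^+ N * expR (b_ N * E N)
    / Num.sqrt (2 * pi * N%:R * var_energy H (b_ N)) * (1 + eps N).
Proof.
pose r N := Num.sqrt (2 * pi * (var_energy H (pos_b_ N) / h ^+ 2)).
exists (fun N => density N * r N - 1).
  have lim : (fun N => density N * r N) @ \oo --> c0 * c0^-1.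
    apply: cvgM; first exact: density_cvg.
    rewrite invrK; apply: continuous_cvg; first exact: sqrt_continuous.
    apply: cvgMl_tmp; apply: cvgMr_tmp; apply: continuous_cvg => //.
    exact: var_energy_continuous.
  have -> : 0 = c0 * c0^-1 - 1 by rewrite divff ?subrr// gt_eqF.
  by apply: cvgB; [exact: lim|exact: cvg_cst].
near=> N; have N0 : (0 < N)%N by near: N; exists 1%N.
have <- : pos_b_ N = b_ N by near: N; apply: filterS pos_bE => N [].
rewrite addrC subrK /density /r.
have ZN := partition_fun_gt0 Zs x0 (pos_b_gt0 N).
have vN := var_energy_gt0 H0 Zs Hx0 Hx1 (pos_b_gt0 N).
have p2 : 0 < 2 * pi :> R by rewrite mulr_gt0// pi_gt0.
have -> : 2 * pi * N%:R * var_energy H (pos_b_ N) =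
    N%:R * (2 * pi * var_energy H (pos_b_ N)) by ring.
have -> : 2 * pi * (var_energy H (pos_b_ N) / h ^+ 2) =
    h^-1 ^+ 2 * (2 * pi * var_energy H (pos_b_ N)) by field; rewrite gt_eqF.
have q0 : 0 < Num.sqrt (2 * pi * var_energy H (pos_b_ N)).
  by rewrite sqrtr_gt0 mulr_gt0.
rewrite sqrtrM// [Num.sqrt (h^-1 ^+ 2 * _)]sqrtrM ?sqr_ge0// sqrtr_sqr.
rewrite ger0_norm ?invr_ge0 ?(ltW h0)// mulNr expRN.
field; rewrite expf_neq0 ?gt_eqF ?expR_gt0 ?sqrtr_gt0 ?ltr0n//.
by rewrite mulr_gt0.
Unshelve. all: by end_near. Qed.

(** In the logarithm of the shell count divided by [N], the contributions of [density] and of the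
    square root of [N] vanish in the limit. *)
Lemma shell_entropy_cvg :
  (fun N => ln ((shell_card H N (E N))%:R : R) / N%:R) @ \oo -->
    log_partition H b + b * u.
Proof.
have lim : (fun N => ln (density N) * N%:R^-1 - ln (Num.sqrt N%:R) / N%:R
    + ln (partition_fun H (pos_b_ N)) + pos_b_ N * (E N / N%:R)) @ \oo -->
    ln c0 * 0 - 0 + log_partition H b + b * u.
  apply: cvgD; last by apply: cvgM => //; exact: pos_b_cvg.
  apply: cvgD; last by apply: continuous_cvg => //; exact: continuous_ln.
  apply: cvgB.
    apply: cvgM; first by apply: continuous_cvg => //; exact: continuous_ln.
    apply/gtr0_cvgV0; last exact: cvgr_idn.
    by near=> N; rewrite ltr0n; near: N; exists 1%N.
  (* For [s] the square root of [N], [ln s <= s] gives [ln s / s ^+ 2 <= s^-1]. *)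
  apply: cvg_dist_le (@cvg_inv_sqrtn R); near=> N.
  have N0 : (0 < N)%N by near: N; exists 1%N.
  have s1 : 1 <= Num.sqrt N%:R :> R by rewrite -[leLHS]sqrtr1 ler_wsqrtr// ler1n.
  have s0 := lt_le_trans ltr01 s1.
  rewrite subr0 ger0_norm ?divr_ge0 ?ln_ge0// ler_pdivrMr ?ltr0n//.
  rewrite -[X in _ * X](@sqr_sqrtr R) ?ler0n// expr2 mulKf ?gt_eqF//.
  by have := expR_ge1Dx (ln (Num.sqrt N%:R : R)); rewrite lnK ?posrE//; lra.
rewrite mulr0 subr0 add0r in lim.
apply: cvg_trans lim; apply: near_eq_cvg; near=> N => /=.
have N0 : (0 < N)%N by near: N; exists 1%N.
have NR : N%:R != 0 :> R by rewrite pnatr_eq0 -lt0n.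
have d0 : 0 < density N by near: N; exact: (cvgr_gt c0).
have ZN := partition_fun_gt0 Zs x0 (pos_b_gt0 N).
have s0 : 0 < Num.sqrt N%:R :> R by rewrite sqrtr_gt0 ltr0n.
have -> : (shell_card H N (E N))%:R = density N / Num.sqrt N%:R *
    partition_fun H (pos_b_ N) ^+ N * expR (pos_b_ N * E N).
  rewrite /density mulNr expRN; field.
  by rewrite expf_neq0 ?gt_eqF ?expR_gt0.
move: (density N) d0 => D d0.
have ds0 : 0 < D / Num.sqrt N%:R by rewrite divr_gt0.
rewrite lnM ?posrE ?expR_gt0 ?mulr_gt0 ?invr_gt0 ?exprn_gt0//.
rewrite lnM ?posrE ?invr_gt0 ?exprn_gt0// ln_div ?posrE// lnXn// expRK -mulr_natr.
by field.
Unshelve. all: by end_near. Qed.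

Lemma shell_entropyE : log_partition H b + b * u = entropy H u.
Proof. by rewrite -[u in RHS]mb (entropy_legendre H0 Zs Hx0 Hx1 b0) mb. Qed.

(** Used with the degree of a fixed marginal point, so that a subtraction of natural numbers is
    eventually the true difference. *)
Let e_large k : \forall N \near \oo, (k <= e N)%N.
Proof.
have u2 : 0 < u / 2 by rewrite divr_gt0.
near=> N; have N0 : (0 < N)%N by near: N; exists 1%N.
have uN : u / 2 <= E N / N%:R.
  by near: N; apply: (cvgr_ge u) => //; rewrite ltr_pdivrMr// ltr_pMr// ltr1n.
have kN : k%:R * h / (u / 2) <= N%:R.
  by near: N; have /cvgryPge := @cvgr_idn R; apply.
rewrite -(@ler_nat R) -(ler_pM2r h0) [leRHS]mulrC -Ee//.
by rewrite ler_pdivrMr// in kN; rewrite ler_pdivlMr ?ltr0n// mulrC in uN; exact: le_trans uN.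
Unshelve. all: by end_near. Qed.

Lemma finite_shell_energy N m : finite_set (shell H (h * m%:R) : set (N.-tuple L)).
Proof.
have [F FP] := finite_sublevel Zs (h * m%:R).
apply: (@finite_shell _ _ _ _ _ h0 Hn N m F) => x xm; apply: FP.
by rewrite Hn ler_pM2l// ler_nat.
Qed.

Lemma shell_marginal_cvg k : (1 <= k)%N ->
  (fun N => tv_dist (pushforward_mass (@proj_first L k N) (shell_measure H (E N)))
     (product_mass (gibbs H b) (k:=k))) @ \oo --> (0 : R).
Proof.
(* Indices are shifted by [k]: tuples have length [k + N], and [N] particles remain after
   projection. *)
move=> k1; rewrite -(cvg_shiftn k).
rewrite (_ : [sequence _]_N = fun N => tv_dist
  (pushforward_mass (@proj_first L k (k + N)) (shell_measure H (E (k + N))))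
  (product_mass (gibbs H b) (k:=k))); last by apply/funext => N; rewrite addnC.
have kN0 N : (0 < k + N)%N by rewrite addn_gt0 k1.
have finS N : finite_set (shell H (E (k + N)) : set ((k + N).-tuple L)).
  by rewrite Ee//; exact: finite_shell_energy.
have us N := nnsummable_uniform R (finS N).
have g0 x : 0 <= gibbs H b x by rewrite mulr_ge0 ?expR_ge0// invr_ge0 ltW.
have gs : nnsummable (gibbs H b) /\ rsum (gibbs H b) = 1.
  have iZ : 0 <= (partition_fun H b)^-1 by rewrite invr_ge0 ltW.
  have [gs ->] := nnsummableZ iZ (Zs b0); split => //.
  by rewrite mulVf// gt_eqF.
apply: tv_dist_cvg0 => [N y|y|N F|F|d d0|y].
- exact: (pushforward_mass_ge0 _ (us N).1 _).
- exact: product_mass_ge0.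
- exact: (le_trans (pushforward_mass_sum_le _ (us N).1 F) (us N).2).
- exact: (product_mass_sum_le1 g0 gs.1 gs.2 F).
- exact: (product_mass_tight k g0 gs.1 gs.2 d0).
pose kap := (\sum_i n (tnth y i))%N.
have yE : total_energy H y = h * kap%:R by exact: total_energy_deg.
(* The parameter of the full system of [k + N] particles is kept for the [N] remaining ones. *)
pose bk N := pos_b_ (k + N)%N.
have shiftE (f : nat -> R) (l : R) : f @ \oo --> l -> (fun N => f (k + N)%N) @ \oo --> l.
  rewrite -(cvg_shiftn k); apply: cvg_trans; apply: near_eq_cvg; apply: nearW => N /=.
  by rewrite addnC.
have bk_cvg : bk @ \oo --> b by exact: shiftE pos_b_cvg.
have nearE (P : nat -> Prop) : (\forall N \near \oo, P N) ->
    \forall N \near \oo, P (k + N)%N.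
  by move=> [M _ MP]; exists M => // N /= MN; apply: MP => /=; rewrite (leq_trans MN)// leq_addl.
pose ek N := (e (k + N) - kap)%N.
have kap_le : \forall N \near \oo, (kap <= e (k + N))%N by exact: nearE (e_large kap).
have bkE : \forall N \near \oo, mean_energy H (bk N) = E (k + N)%N / (k + N)%:R.
  by apply: filterS (nearE _ pos_bE) => N [].
have Eu : (fun N => E (k + N)%N / (k + N)%:R) @ \oo --> u.
  exact: (shiftE (fun N => E N / N%:R)).
(* Since the full shell is exactly centred, the shift is [kap%:R - k%:R * (mean_energy H (bk N) /
   h)], and the mean energy is eventually at most [u + 1]. *)
pose K := kap%:R + k%:R * ((u + 1) / h).
have ek_shift : \forall N \near \oo,
    `|N%:R * (mean_energy H (bk N) / h) - (ek N)%:R| <= K.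
  near=> N.
  have mE : mean_energy H (bk N) = E (k + N)%N / (k + N)%:R by near: N; exact: bkE.
  have kle : (kap <= e (k + N))%N by near: N; exact: kap_le.
  have m0 := mean_energy_gt0 H0 Zs x0 Hx1 (pos_b_gt0 (k + N)).
  have mu : mean_energy H (bk N) <= u + 1.
    by rewrite mE; near: N; apply: (cvgr_le u) => //; rewrite ltrDl.
  have kNR : (k + N)%:R != 0 :> R by rewrite pnatr_eq0 -lt0n.
  have eE : (e (k + N))%:R = (k + N)%:R * (mean_energy H (bk N) / h).
    rewrite mE Ee//; move: (k + N)%:R kNR (e _)%:R => a a0 c.
    by field; rewrite a0 gt_eqF.
  rewrite /ek natrB// eE natrD.
  rewrite (_ : _ - _ = kap%:R - k%:R * (mean_energy H (bk N) / h)); last by ring.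
  rewrite (le_trans (ler_normB _ _))// ger0_norm// ger0_norm; last first.
    by rewrite mulr_ge0// divr_ge0// ltW.
  by rewrite /K lerD2l ler_wpM2l// ler_pM2r ?invr_gt0.
have lim1 := shell_local_limit h0 Hn Zs Hx0 Hx1 C0 aperiodic b0
  (fun N => pos_b_gt0 (k + N)) bk_cvg ek_shift.
have lim2 := shiftE _ _ density_cvg.
have ratio : (fun N => Num.sqrt (k + N)%:R / Num.sqrt N%:R) @ \oo --> (1 : R).
  apply: (@cvg_dist_le _ _ (fun N => k%:R * (Num.sqrt N%:R)^-1)); last first.
    by rewrite -(mulr0 k%:R); apply: cvgMl_tmp; exact: cvg_inv_sqrtn.
  near=> N; have N0 : (0 < N)%N by near: N; exists 1%N.
  have s0 : 0 < Num.sqrt N%:R :> R by rewrite sqrtr_gt0 ltr0n.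
  have -> : Num.sqrt (k + N)%:R / Num.sqrt N%:R - 1 =
      (Num.sqrt (k + N)%:R - Num.sqrt N%:R) / Num.sqrt N%:R :> R.
    by field; rewrite gt_eqF.
  rewrite normrM normfV (gtr0_norm s0) ler_pM2r ?invr_gt0//.
  rewrite ger0_norm ?subr_ge0 ?ler_wsqrtr ?ler_nat ?leq_addl//.
  have kN : 0 <= k%:R + Num.sqrt N%:R :> R by rewrite addr_ge0.
  rewrite lerBlDr -[leRHS]ger0_norm// -sqrtr_sqr ler_wsqrtr// sqrrD sqr_sqrtr//.
  rewrite natrD lerD2r -natrX ler_wpDr ?mulrn_wge0 ?mulr_ge0//.
  by rewrite ler_nat leq_pmulr.
have lim3 : (fun N => expR (- bk N * (h * kap%:R)) / partition_fun H (bk N) ^+ k)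
    @ \oo --> expR (- b * (h * kap%:R)) / partition_fun H b ^+ k.
  apply: cvgM.
    apply: continuous_cvg; first exact: continuous_expR.
    by apply: cvgMr_tmp; apply: cvgN.
  apply: cvgV; first by rewrite expf_neq0// gt_eqF.
  apply: (@continuous_cvg _ _ _ \oo _ (fun N => partition_fun H (bk N))
    (fun z : R => z ^+ k)); first exact: exprn_continuous.
  exact: (shiftE _ _ Zcvg).
(* Quotient of the two local limits: [c0] cancels, and the last two factors correct for the
   different square roots and supply the Gibbs weight of [y]. *)
have lim : (fun N => Num.sqrt N%:R * ((shell_card H N (h * (ek N)%:R))%:R *
      expR (- bk N * (h * (ek N)%:R)) / partition_fun H (bk N) ^+ N)
    / density (k + N) * (Num.sqrt (k + N)%:R / Num.sqrt N%:R) *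
    (expR (- bk N * (h * kap%:R)) / partition_fun H (bk N) ^+ k)) @ \oo -->
    c0 / c0 * 1 * (expR (- b * (h * kap%:R)) / partition_fun H b ^+ k).
  apply: cvgM; last exact: lim3.
  apply: cvgM; last exact: ratio.
  apply: cvgM; first exact: lim1.
  by apply: cvgV; [rewrite gt_eqF|exact: lim2].
rewrite divff ?gt_eqF// !mul1r in lim.
have -> : product_mass (gibbs H b) y = expR (- b * (h * kap%:R)) / partition_fun H b ^+ k.
  rewrite /product_mass /gibbs big_split/= prodr_const card_ord -expR_sum -mulr_sumr.
  by rewrite -/(total_energy H y) yE mulrC exprVn.
apply: (cvg_trans _ lim); apply: near_eq_cvg; near=> N => /=.
have N0 : (0 < N)%N by near: N; exists 1%N.
have kle : (kap <= e (k + N))%N by near: N; exact: kap_le.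
have d0 : 0 < density (k + N) by near: N; exact: (cvgr_gt c0).
have EE : E (k + N)%N - total_energy H y = h * (ek N)%:R.
  by rewrite Ee// yE -mulrBr natrB.
rewrite pushforward_shell; last by rewrite EE; exact: finite_shell_energy.
rewrite EE.
have Ek : h * kap%:R = E (k + N)%N - h * (ek N)%:R by rewrite -EE yE subKr.
rewrite Ek mulrBr [expR (_ - _)]expRD expRN.
move: d0; rewrite /density -/(bk N).
have sk : 0 < Num.sqrt (k + N)%:R :> R by rewrite sqrtr_gt0 ltr0n.
have s0 : 0 < Num.sqrt N%:R :> R by rewrite sqrtr_gt0 ltr0n.
have ZN : 0 < partition_fun H (bk N) := partition_fun_gt0 Zs x0 (pos_b_gt0 (k + N)).
rewrite exprD.
(* An empty full shell would make [density] vanish. *)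
have [->|gN0 _] := eqVneq (shell_card H (k + N) (E (k + N)%N)) 0%N.
  by rewrite !mul0r mulr0 ltxx.
field.
by rewrite pnatr_eq0 gN0 !expf_neq0 ?gt_eqF ?expR_gt0.
Unshelve. all: by end_near. Qed.

End microcanonical.

Theorem theorem13 (R : realType) (d : nat) (L : vectType int) (V : lmodType R)
    (iota : {additive L -> V}) (nrm : V -> R) (h u : R) (E : nat -> R)
    (d_ge1 : (1 <= d)%N) (rank_L : dim L = d)
    (V_ext : extension_of_scalars iota) (nrm_eucl : euclidean_norm nrm)
    (H := energy iota nrm)
    (H_lattice : is_lattice (range H)) (h_span : maximal_span (range H) h)
    (E_im : forall N : nat, (1 <= N)%N -> range (@total_energy R L H N) (E N))
    (u_gt0 : 0 < u) (E_cvg : (fun N : nat => E N / N%:R) @ \oo --> u) :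
  let beta := mean_energy_inv H u in
  let u_ := fun N : nat => E N / N%:R in
  let beta_ := fun N : nat => mean_energy_inv H (u_ N) in
  [/\ forall k : nat, (1 <= k)%N ->
        (fun N : nat => tv_dist
           (pushforward_mass (@proj_first L k N) (shell_measure H (E N)))
           (product_mass (gibbs H beta) (k:=k))) @ \oo --> (0 : R),
      \forall N \near \oo, 0 < u_ N,
      exists2 eps : nat -> R, eps @ \oo --> (0 : R) &
        \forall N \near \oo,
          (shell_card H N (E N))%:R
          = h * partition_fun H (beta_ N) ^+ N * expR (beta_ N * E N)
            / Num.sqrt (2 * pi * N%:R * var_energy H (beta_ N))
            * (1 + eps N),
      (fun N : nat => ln ((shell_card H N (E N))%:R : R) / N%:R) @ \oo -->
        log_partition H beta + beta * u
    & log_partition H beta + beta * u = entropy H u].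
Proof.
have d0 : (0 < dim L)%N by rewrite rank_L.
have [h0 Hh _] := h_span.
have H0 : forall x, 0 <= H x := energy_ge0 iota nrm.
have /choice[n Hn] : forall x, exists m : nat, H x = h * m%:R.
  move=> x; have [|z _ zx] := Hh (H x); first by exists x.
  exists `|z|%N; rewrite -zx natr_absz ger0_norm// -(ler_int R) -(pmulr_rge0 _ h0).
  by rewrite [_ * _]zx; exact: H0.
have Zs b (b0 : 0 < b) : nnsummable (fun x => expR (- b * H x)).
  exact: nnsummable_lattice.
have [F0 [C [C0 aper]]] := span_aperiodic h0 Hn h_span.
have Hx0 : H 0 = 0 by exact: energy0.
(* If [n] vanished on all of [F0], [aper] at [pi] would read [2 <= 0]. *)
have [x1 Hx1] : exists x1, 0 < H x1.
  have [x1 _ nx1] : exists2 x, x \in F0 & n x != 0%N.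
    apply/hasP; apply: contraT; rewrite -all_predC => /allP nF0.
    have := aper pi; rewrite cospi big_seq big1 ?mulr0 => [|x xF0]; first by lra.
    by have := nF0 x xF0; rewrite /= negbK => /eqP ->; rewrite mulr0 cos0 subrr.
  by exists x1; rewrite Hn mulr_gt0// ltr0n lt0n.
have infL k : exists F : {fset L}, (k <= #|` F|)%N by exact: lattice_infinite.
have /choice[e Ee'] : forall N, exists m : nat, (0 < N)%N -> E N = h * m%:R.
  (* [E 0] is unconstrained; the value chosen there is a dummy. *)
  move=> N; case: (posnP N) => [->|N0]; first by exists 0%N.
  have [x _ <-] := E_im N N0; exists (\sum_i n (tnth x i))%N => _.
  exact: total_energy_deg.
split.
- by move=> k; exact: (shell_marginal_cvg h0 Hn Zs Hx0 Hx1 C0 aper infL Ee' u_gt0 E_cvg).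
- exact: (mean_shell_energy_gt0 u_gt0 E_cvg).
- exact: (shell_card_asymp h0 Hn Zs Hx0 Hx1 C0 aper infL Ee' u_gt0 E_cvg).
- exact: (shell_entropy_cvg h0 Hn Zs Hx0 Hx1 C0 aper infL Ee' u_gt0 E_cvg).
- exact: (shell_entropyE h0 Hn Zs Hx0 Hx1 infL u_gt0).
Qed.
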